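(* Assume (A1)–(A4), $P^\star\in\Pi_{K^\star}\setminus\Pi_{K^\star-1}$ with $K^\star<\infty$, and that the penalty has the form $\mathrm{pen}(n,K)=v_nD(K)$ where $D:\mathbb N\to\mathbb R$, $(v_n)$ is an increasing sequence of positive numbers with $v_n=o(n)$, and there exist $A\ge1$, $\delta\in(0,1)$ with $v_{nk}\le Ak^{1-\delta}v_n$ for all $k,n\ge1$. Suppose also (i) $u-l\in\mathcal L_\tau(P^\star)$ and (ii) $n=o(v_n^2)$. (a) If $\mathcal G^a_{K^\star+1}$ is $P^\star$-Donsker, then $\limsup_{n\to\infty}n v_n^{-2}\log P^\star\{\widehat K_n^L>K^\star\}<0$. (b) If $K^\star\le K_{\max}$ and $\mathcal G^a_{K_{\max}}$ is $P^\star$-Donsker, then $\limsup_{n\to\infty}n v_n^{-2}\log P^\star\{\widehat K_n^G>K^\star\}<0$.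
   Context: Setting: $(\mathcal Z,\mathcal F)$ is a Polish space with its Borel $\sigma$-field and $\mu$ a $\sigma$-finite measure on it. $Z_1,Z_2,\dots$ are i.i.d. $\mathcal Z$-valued random variables with common law $P^\star\ll\mu$, density $p^\star$, $\ell^\star=\log p^\star$; $P^\star$ also denotes the law of the whole sequence. $\{(\Theta_K,d)\}_{K\ge1}$ is an increasing (nested) sequence of metric spaces, $\Theta_\infty=\bigcup_K\Theta_K$; for $\theta\in\Theta_\infty$, $P_\theta$ is a probability measure with density $p_\theta$ w.r.t. $\mu$ and $\ell_\theta=\log p_\theta$. $\Pi_K=\{P_\theta:\theta\in\Theta_K\}$, $\Pi_0=\emptyset$. The order of $P^\star$ is $K^\star=\min\{K:P^\star\in\Pi_K\}$. $\lambda f=\int f\,d\lambda$. Given a penalty $\mathrm{pen}(n,K)>0$, $\mathrm{crit}(n,K)=\sup_{\theta\in\Theta_K}\sum_{i=1}^n\ell_\theta(Z_i)-\mathrm{pen}(n,K)$, $\widehat K_n^L=\inf\{K\ge1:\mathrm{crit}(n,K)\ge\mathrm{crit}(n,K+1)\}$, and $\widehat K_n^G$ is the smallest maximizer of $K\mapsto\mathrm{crit}(n,K)$ (the maximization being over $1\le K\le K_{\max}$ when a known bound $K_{\max}\ge K^\star$ is assumed). All suprema are assumed measurable. Standing assumptions: (A1) each $(\Theta_K,d)$ is compact and each $\Pi_K$ is compact for the weak topology; (A2) for each $z$ and $K$, $\theta\mapsto\ell_\theta(z)$ is continuous on $\Theta_K$; (A3) there are $l,u:\mathcal Z\to\mathbb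 R$ with $u-l\in L^1(P^\star)$, $l\le\ell^\star\le u$ and $l\le\ell_\theta\le u$ for all $\theta\in\Theta_\infty$; (A4) for each $n$, $\mathrm{pen}(n,\cdot)$ is increasing, and for each $K$, $\mathrm{pen}(n,K)\to\infty$ and $\mathrm{pen}(n,K)=o(n)$ as $n\to\infty$. Additional notation: $\tau(s)=e^{|s|}-|s|-1$, $\mathcal L_\tau(P^\star)=\{f:\mathcal Z\to\mathbb R:\exists a>0,\ P^\star\tau(f/a)<\infty\}$. $\mathcal G^a_K=\{\ell_\theta-\ell^\star:\theta\in\Theta_K\}$. ''$P^\star$-Donsker'' is the standard notion for a class of functions. *)

(* Defs.v *)
From HB Require Import structures.
From mathcomp Require Import all_boot all_order all_algebra.
From mathcomp Require Import all_classical all_reals all_analysis measurable_realfun.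
Set Implicit Arguments.
Unset Strict Implicit.
Unset Printing Implicit Defensive.
Import Order.TTheory GRing.Theory Num.Theory numFieldNormedType.Exports.
Local Open Scope classical_set_scope.
Local Open Scope ring_scope.

Definition Borel (Z : ptopologicalType) := g_sigma_algebraType (@open Z).

(* A Polish space, presented with a compatible complete metric:
   Hausdorff (so the pseudometric is a metric) and separable. *)
Definition polish {R : realType} (Z : completePseudoMetricType R) : Prop :=
  hausdorff_space Z /\ exists D : set Z, countable D /\ dense D.

Section Model.
Context {R : realType} {Z : completePseudoMetricType R}.
Local Notation ZB := (Borel Z).
Context (mu : {measure set ZB -> \bar R}).

Definition is_density (f : Z -> R) : Prop :=
  measurable_fun [set: ZB] (f : ZB -> R) /\ (forall x, 0 <= f x) /\
  (\int[mu]_x (f x)%:E = 1)%E.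

Definition dmeas (f : Z -> R) (A : set ZB) : \bar R :=
  (\int[mu]_(x in A) (f x)%:E)%E.

Definition dexp (f : Z -> R) (g : Z -> R) : \bar R :=
  (\int[mu]_x (g x * f x)%:E)%E.

Definition same_law (f1 f2 : Z -> R) : Prop :=
  forall A : set ZB, measurable A -> dmeas f1 A = dmeas f2 A.

(* P^star \in Pi_K (with Pi_0 = empty) *)
Definition in_model {Theta : Type} (ThetaK : nat -> set Theta)
  (p : Theta -> Z -> R) (pstar : Z -> R) (K : nat) : Prop :=
  (0 < K)%N /\ exists2 th, ThetaK K th & same_law (p th) pstar.

Definition bcf := {f : Z -> R | continuous f /\ exists M, forall x, `|f x| <= M}.

(* P |-> (int f dP)_{f bounded continuous}: the weak topology on probability
   measures on Z is by definition the initial topology of this map, so a set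
   of probability measures is weakly compact iff its image is compact in the
   product (pointwise) topology. *)
Definition weak_coord (f : Z -> R) : {ptws bcf -> R} :=
  fun g => fine (\int[mu]_x ((proj1_sig g) x * f x)%:E)%E.

Definition weakly_compact_model {Theta : Type} (ThetaK : nat -> set Theta)
  (p : Theta -> Z -> R) (K : nat) : Prop :=
  compact ((fun th => weak_coord (p th)) @` ThetaK K).

Definition tau (s : R) : R := expR `|s| - `|s| - 1.

Definition in_Ltau (pstar : Z -> R) (f : Z -> R) : Prop :=
  exists2 a : R, 0 < a & (dexp pstar (fun x => tau (f x / a)) < +oo)%E.

End Model.

Section Sample.
Context {R : realType} {Z : completePseudoMetricType R}.
Local Notation ZB := (Borel Z).
Context {d0 : measure_display} {Omega : measurableType d0}
  (P : probability Omega R) (X : nat -> Omega -> ZB).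

Definition iid (law : set ZB -> \bar R) : Prop :=
  (forall i, measurable_fun [set: Omega] (X i)) /\
  (forall i (A : set ZB), measurable A -> P (X i @^-1` A) = law A) /\
  (forall (s : seq nat) (A : nat -> set ZB), uniq s ->
     (forall i, measurable (A i)) ->
     P (\bigcap_(i in [set i | i \in s]) X i @^-1` A i) =
     (\big[*%E/1%E]_(i <- s) P (X i @^-1` A i))%E).

(* outer expectation (for bounded Y) *)
Definition oexp (Y : Omega -> R) : \bar R :=
  ereal_inf [set (\int[P]_w (W w)%:E)%E | W in
     [set W : Omega -> R | measurable_fun [set: Omega] W /\ forall w, Y w <= W w]].

Section Empirical.
Context (mu : {measure set ZB -> \bar R}) (pstar : Z -> R) (F : set (Z -> R)).

Definition fclass : Type := {f : Z -> R | F f}.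
HB.instance Definition _ := gen_eqMixin fclass.
HB.instance Definition _ := gen_choiceMixin fclass.

Definition emp_proc (n : nat) (w : Omega) : {uniform fclass -> R} :=
  fun f => (Num.sqrt (n%:R))^-1 *
    \sum_(i < n) (proj1_sig f (X i w) - fine (dexp mu pstar (proj1_sig f))).

Definition linf_bounded (g : {uniform fclass -> R}) : Prop :=
  exists M, forall f, `|g f| <= M.

(* F is P-Donsker: G_n converges weakly (Hoffmann-Jorgensen sense, outer
   expectations) in l^infty(F) to a tight Borel measurable limit. *)
Definition donsker : Prop :=
  exists (d' : measure_display) (Omega' : measurableType d')
         (P' : probability Omega' R) (G : Omega' -> {uniform fclass -> R}),
    (forall w, linf_bounded (G w)) /\
    (forall U : set {uniform fclass -> R}, open U -> measurable (G @^-1` U)) /\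
    (forall eps : R, 0 < eps -> exists C : set {uniform fclass -> R},
        [/\ C `<=` linf_bounded, compact C & ((1 - eps)%:E <= P' (G @^-1` C))%E]) /\
    (forall h : {uniform fclass -> R} -> R,
        {within linf_bounded, continuous h} ->
        (exists M, forall g, linf_bounded g -> `|h g| <= M) ->
        (fun n => oexp (fun w => h (emp_proc n w))) @ \oo -->
          (\int[P']_w (h (G w))%:E)%E).
End Empirical.

Section Selection.
Context {Theta : Type} (ThetaK : nat -> set Theta) (p : Theta -> Z -> R)
  (pen : nat -> nat -> R).

Definition loglik (n : nat) (th : Theta) (w : Omega) : R :=
  \sum_(i < n) ln (p th (X i w)).

(* sup_{theta in Theta_K} sum_{i<n} l_theta(X_i)  (= -oo if Theta_K empty) *)
Definition suplik (n K : nat) (w : Omega) : \bar R :=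
  ereal_sup [set (loglik n th w)%:E | th in ThetaK K].

Definition crit (n K : nat) (w : Omega) : \bar R := (suplik n K w - (pen n K)%:E)%E.

(* \hat K^L_n = inf{K >= 1 : crit(n,K) >= crit(n,K+1)}, None = +infinity *)
Definition KhatL (n : nat) (w : Omega) : option nat :=
  match pselect (exists K, `[< (0 < K)%N /\ (crit n K.+1 w <= crit n K w)%E >]) with
  | left h => Some (ex_minn h)
  | right _ => None
  end.

Definition KhatG (Kmax n : nat) (w : Omega) : nat :=
  match pselect (exists K, `[< (0 < K <= Kmax)%N /\
      forall j, (0 < j <= Kmax)%N -> (crit n j w <= crit n K w)%E >]) with
  | left h => ex_minn h
  | right _ => 0%N
  end.

Definition gt_opt (o : option nat) (k : nat) : Prop :=
  match o with Some m => (k < m)%N | None => True end.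

End Selection.
End Sample.

Section Rate.
Context {R : realType}.
(* the sequence n v_n^{-2} log q_n, with log 0 = -oo *)
Definition log_rate (v : nat -> R) (q : nat -> \bar R) (n : nat) : \bar R :=
  if fine (q n) == 0 then -oo%E
  else ((n%:R / (v n ^+ 2)) * ln (fine (q n)))%:E.
End Rate.

(* Main.v *)
(** Overestimating the order forces the centered log-likelihood ratio sums
    [S_n] over the model to exceed a multiple of [v_n] somewhere, since the ratios
    have nonpositive mean (Gibbs) and [p_theta*] agrees with [pstar] almost surely.
    By compactness and continuity it suffices to bound the maximum of [|S_n|] over
    finitely many parameters, uniformly in their number.  Yurinskii's martingale
    argument does this: integrating out the observations one at a time turns a
    Lipschitz functional [phi] of [S_n] into a constant [m_n], and the exponential
    moment of [u - l] gives [E exp (lam (phi(S_n) - m_n)) <= exp (C n lam^2)] for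
    [|lam| <= lam0].  The Donsker property makes [phi(S_n) / sqrt n] tight, so
    [lam = - 1 / sqrt n] yields [m_n = O(sqrt n) = o(v_n)], and
    [lam = eta v_n / n] yields the bound [exp (- k v_n^2 / n)]. *)

Require Import Defs.
From HB Require Import structures.
From mathcomp Require Import all_boot all_order all_algebra.
From mathcomp Require Import all_classical all_reals all_analysis measurable_realfun.
From mathcomp Require Import ring lra.
Import Order.TTheory GRing.Theory Num.Theory numFieldNormedType.Exports.
Local Open Scope classical_set_scope.
Local Open Scope ring_scope.

(** * Independence and the sigma-algebra of past observations *)

(** The rectangle hypothesis identifies the joint law of [(Y, V)] with the product of the law of [Y]
    and [Q], by uniqueness of product measures; Tonelli then applies. *)
Lemma integral_indep {R : realType} {d d1 d2 : measure_display}
  {Omega : measurableType d} {T : measurableType d1} {Z : measurableType d2}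
  (P : probability Omega R) (Q : probability Z R)
  (Y : Omega -> T) (V : Omega -> Z) (f : T * Z -> \bar R) :
  measurable_fun setT Y -> measurable_fun setT V ->
  (forall A B, measurable A -> measurable B ->
     P (Y @^-1` A `&` V @^-1` B) = P (Y @^-1` A) * Q B)%E ->
  measurable_fun setT f -> (forall t, 0 <= f t)%E ->
  (\int[P]_w f (Y w, V w) = \int[P]_w \int[Q]_x f (Y w, x))%E.
Proof.
move=> mY mV ind mf f0.
have mYV : measurable_fun setT (fun w => (Y w, V w)) by exact: measurable_fun_pair.
pose Yp : {mfun Omega >-> T} := HB.pack Y (isMeasurableFun.Build _ _ _ _ _ mY).
pose YVp : {mfun Omega >-> (T * Z)%type} :=
  HB.pack (fun w => (Y w, V w)) (isMeasurableFun.Build _ _ _ _ _ mYV).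
pose PY := distribution P Yp.
pose PYV := distribution P YVp.
have prodE A : measurable A -> (PY \x Q)%E A = PYV A.
  apply: product_measure_unique => B C mB mC.
  by rewrite /PY /PYV /distribution /pushforward /= -ind.
transitivity (\int[PYV]_z f z)%E.
  by rewrite /PYV /distribution ge0_integral_pushforward.
transitivity (\int[PY \x Q]_z f z)%E.
  by apply: eq_measure_integral => A mA _; exact/esym/prodE.
rewrite fubini_tonelli1//.
rewrite /PY /distribution ge0_integral_pushforward//.
  exact: measurable_fun_fubini_tonelli_F.
by move=> y _; apply: integral_ge0.
Qed.

Section past.
Context {R : realType} {d d' : measure_display} {Omega : measurableType d}
  {Z : measurableType d'} (P : probability Omega R) (X : nat -> Omega -> Z).

Definition past_cylinders (n : nat) : set (set Omega) :=
  [set E | exists2 A : nat -> set Z, (forall i, measurable (A i)) &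
     E = \bigcap_(i in [set i | (i < n)%N]) X i @^-1` A i].

(** The sigma-algebra generated by the first [n] observations, placed on [Omega] itself: the
    identity into [past n] then plays the role of the vector of these observations, and no product
    space is needed. *)
Definition past (n : nat) := g_sigma_algebraType (past_cylinders n).

Hypothesis mX : forall i, measurable_fun setT (X i).

Lemma measurable_past_cylinders n E : past_cylinders n E -> measurable E.
Proof.
move=> [A mA ->]; apply: bigcap_measurableType => i _.
by rewrite -[X in measurable X]setTI; apply: mX.
Qed.

Lemma measurable_fun_past n : measurable_fun setT (id : Omega -> past n).
Proof.
apply: (@measurability _ _ Omega (past n) setT id (past_cylinders n) erefl).
move=> _ [B GB <-]; rewrite setTI.
exact: measurable_past_cylinders GB.
Qed.

Lemma past_measurable_fun n i : (i < n)%N ->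
  measurable_fun setT (X i : past n -> Z).
Proof.
move=> ltin _ B mB; rewrite setTI.
apply: sub_sigma_algebra => /=.
exists (fun k => if k == i then B else setT).
  by move=> k; case: ifP.
apply/seteqP; split=> w /=.
  by move=> XiB k _; case: eqP => [->|].
by move=> /(_ i ltin); rewrite eqxx.
Qed.

Hypothesis ind : forall (s : seq nat) (A : nat -> set Z), uniq s ->
     (forall i, measurable (A i)) ->
     P (\bigcap_(i in [set i | i \in s]) X i @^-1` A i) =
     (\big[*%E/1%E]_(i <- s) P (X i @^-1` A i))%E.

(** For fixed [B] both sides are finite measures in [A]. They agree on cylinders by [ind], and
    cylinders form a generating pi-system. *)
Lemma past_indep n (A : set (past n)) (B : set Z) :
  measurable A -> measurable B ->
  (P (A `&` X n @^-1` B) = P A * P (X n @^-1` B))%E.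
Proof.
move=> mA mB.
have mXB : measurable (X n @^-1` B).
  by rewrite -[X in measurable X]setTI; apply: mX.
have finB : P (X n @^-1` B) \is a fin_num by exact: fin_num_measure.
have pB0 : 0 <= fine (P (X n @^-1` B)) by rewrite fine_ge0.
pose c := NngNum pB0.
pose m1 := mrestr P mXB.
pose m2 := mscale c P.
suff : m1 A = m2 A.
  by rewrite /m1 /m2 /mrestr /mscale /= fineK// muleC.
apply: (@g_sigma_algebra_measure_unique _ _ _ (past_cylinders n) _ (fun=> setT)) => //.
- exact: measurable_past_cylinders.
- move=> _; exists (fun=> setT) => //.
  by apply/seteqP; split.
- by rewrite bigcup_const.
- move=> _ _ [A1 mA1 ->] [A2 mA2 ->].
  exists (fun i => A1 i `&` A2 i); first by move=> i; exact: measurableI.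
  by rewrite -bigcapI.
- move=> _ [A1 mA1 ->]; rewrite /m1 /m2 /= /mrestr /mscale /= fineK//.
  (* Placing [B] at index [n] turns the intersection into one cylinder of length [n.+1], to which
     [ind] applies. *)
  pose A' i := if i == n then B else A1 i.
  have mA' i : measurable (A' i) by rewrite /A'; case: ifP.
  have iotaE k : [set i | (i < k)%N] = [set i | i \in iota 0 k].
    by apply/seteqP; split => i /=; rewrite mem_iota.
  have -> : \bigcap_(i in [set i | (i < n)%N]) X i @^-1` A1 i `&` X n @^-1` B =
    \bigcap_(i in [set i | (i < n.+1)%N]) X i @^-1` A' i.
    apply/seteqP; split => [w [/= H1 H2] i /=|w /= H].
      rewrite ltnS leq_eqVlt /A'.
      by case: eqP => [->//|_ /= ltin]; exact: H1.
    split.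
      move=> i /= ltin; have /= := H i (ltnW ltin).
      by rewrite /A' (ltn_eqF ltin).
    by have /= := H n (ltnSn n); rewrite /A' eqxx.
  rewrite !iotaE.
  rewrite !ind ?iota_uniq// -addn1 iotaD add0n big_cat /= big_seq1 /A' eqxx muleC.
  congr (_ * _)%E; apply: eq_big_seq => i; rewrite mem_iota /= add0n => ltin.
  by rewrite (ltn_eqF ltin).
- by move=> _; rewrite /m1 /= /mrestr setTI ltey_eq finB.
Qed.

End past.

(** * Exponential inequalities and integrability of real functions *)

(** A second-order Taylor bound: for a centered variable the linear term integrates to zero, so only
    a quadratic cost remains. *)
Lemma expR_le_quadratic {R : realType} (y : R) :
  expR y <= 1 + y + y ^+ 2 * expR `|y|.
Proof.
have e1 : 1 <= expR `|y| by rewrite -expR0 ler_expR.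
have [ylt|yge] := ltP y (-1).
  have : expR y <= 1 by rewrite -expR0 ler_expR; lra.
  by nra.
have ey : expR y * (1 - y) <= 1.
  have := expR_ge1Dx (- y); rewrite expRN => h.
  have ep := expR_gt0 y.
  rewrite mulrC -ler_pdivlMr// mul1r; lra.
have : expR y <= expR `|y| by rewrite ler_expR ler_norm.
have := expR_gt0 y; nra.
Qed.

Lemma sqr_le_expR {R : realType} (x : R) : 0 <= x -> x ^+ 2 <= 4 * expR x.
Proof.
move=> x0; have h := expR_ge1Dx (x / 2).
have -> : expR x = expR (x / 2) ^+ 2.
  by rewrite expr2 -expRD; congr expR; lra.
nra.
Qed.

Lemma Rintegral_probability_cst {R : realType} {d : measure_display}
  {Z : measurableType d} (Q : probability Z R) (r : R) : \int[Q]_x r = r.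
Proof.
rewrite Rintegral_cst// [X in fine X](_ : _ = 1%E) ?mulr1//.
exact: probability_setT.
Qed.

Section integrable_EFin.
Context {R : realType} {d : measure_display} {Z : measurableType d}
  (Q : {measure set Z -> \bar R}).
Implicit Types f g : Z -> R.

Lemma integrable_EFinD f g : Q.-integrable setT (EFin \o f) ->
  Q.-integrable setT (EFin \o g) ->
  Q.-integrable setT (EFin \o (fun x => f x + g x)).
Proof. by move=> fi gi; have := integrableD measurableT fi gi. Qed.

Lemma integrable_EFinB f g : Q.-integrable setT (EFin \o f) ->
  Q.-integrable setT (EFin \o g) ->
  Q.-integrable setT (EFin \o (fun x => f x - g x)).
Proof. by move=> fi gi; have := integrableB measurableT fi gi. Qed.

Lemma integrable_EFinZ (r : R) f : Q.-integrable setT (EFin \o f) ->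
  Q.-integrable setT (EFin \o (fun x => r * f x)).
Proof. by move=> fi; have := integrableZl measurableT r fi. Qed.

Lemma integrable_EFin_norm f : Q.-integrable setT (EFin \o f) ->
  Q.-integrable setT (EFin \o (fun x => `|f x|)).
Proof. by move=> fi; have := integrable_abse fi. Qed.

End integrable_EFin.

Lemma integrable_EFin_cst {R : realType} {d : measure_display}
  {Z : measurableType d} (Q : probability Z R) (r : R) :
  Q.-integrable setT (EFin \o (fun=> r)).
Proof. exact: finite_measure_integrable_cst. Qed.

(** * Integrating out one observation from a Lipschitz functional *)

Section lipschitz_step.
Context {R : realType}.

(* Measurability is required after composition with arbitrary measurable
   coordinates, so that no sigma-algebra on [nat -> R] is needed. *)
Definition lip_measurable (phi : (nat -> R) -> R) : Prop :=
  [/\ forall s, 0 <= phi s,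
      forall (s s' : nat -> R) (e : R), (forall j, `|s j - s' j| <= e) -> phi s <= phi s' + e &
      forall (d : measure_display) (T : measurableType d) (g : nat -> T -> R),
        (forall j, measurable_fun setT (g j)) ->
        measurable_fun setT (fun t => phi (fun j => g j t))].

Context {d : measure_display} {Z : measurableType d} (Q : probability Z R)
  (h : nat -> Z -> R) (F : Z -> R).

(** The conditional expectation of [phi] of the next partial sum when the current one is [s]; its
    iterates produce the Doob martingale of the functional. *)
Definition lip_step (phi : (nat -> R) -> R) (s : nat -> R) : R :=
  \int[Q]_x phi (fun j => s j + h j x).

Hypothesis mh : forall j, measurable_fun setT (h j).
Hypothesis intF : Q.-integrable setT (EFin \o F).
Hypothesis hF : forall j x, `|h j x| <= F x.

Lemma lip_shift phi s x : lip_measurable phi ->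
  `|phi (fun j => s j + h j x) - phi s| <= F x.
Proof.
move=> [_ phiL _]; rewrite ler_norml; apply/andP; split.
  rewrite lerBrDr addrC lerBlDr.
  apply: phiL => j; rewrite opprD addrA subrr sub0r normrN.
  exact: hF.
rewrite lerBlDl.
by apply: phiL => j; rewrite addrAC subrr add0r; exact: hF.
Qed.

Lemma lip_shift_integrable phi s : lip_measurable phi ->
  Q.-integrable setT (EFin \o (fun x => phi (fun j => s j + h j x))).
Proof.
move=> phiP; have [phi0 phiL phim] := phiP.
have ic : Q.-integrable setT (EFin \o (fun x => phi s + F x)).
  by apply: integrable_EFinD => //; exact: integrable_EFin_cst.
apply: le_integrable ic => //.
  apply/measurable_EFinP; apply: phim => j.
  exact: measurable_funD.
move=> x _ /=; rewrite lee_fin.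
have := lip_shift _ s x phiP; rewrite ler_norml => /andP[_].
rewrite lerBlDl => h1.
by rewrite !ger0_norm//; apply: le_trans h1.
Qed.

(** This closure is what allows iteration. Measurability comes from Tonelli on [T * Z], so [phi]
    must be measurable along coordinates on that product as well as on [T]. *)
Lemma lip_stepP phi : lip_measurable phi -> lip_measurable (lip_step phi).
Proof.
move=> phiP; have [phi0 phiL phim] := phiP; split.
- by move=> s; apply: Rintegral_ge0.
- move=> s s' e sse; rewrite /lip_step.
  have -> : e = \int[Q]_x (cst e x).
    by rewrite Rintegral_probability_cst.
  rewrite -RintegralD//; last 2 first.
  + exact: lip_shift_integrable.
  + exact: integrable_EFin_cst.
  apply: le_Rintegral => //.
  + exact: lip_shift_integrable.
  + apply: integrable_EFinD; first exact: lip_shift_integrable.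
    exact: integrable_EFin_cst.
  + move=> x _ /=; apply: phiL => j.
    by rewrite opprD addrACA subrr addr0.
- move=> d1 T g mg.
  rewrite /lip_step /Rintegral.
  apply: measurableT_comp => //.
  pose f := fun tx : T * Z => (phi (fun j => g j tx.1 + h j tx.2))%:E.
  apply: (@measurable_fun_fubini_tonelli_F _ _ _ _ _ Q f).
  + apply/measurable_EFinP; apply: phim => j; apply: measurable_funD.
      exact: (measurableT_comp (mg j) measurable_fst).
    exact: (measurableT_comp (mh j) measurable_snd).
  + by move=> x; rewrite /f lee_fin.
Qed.

Let EF := \int[Q]_x F x.

Lemma lip_step_dist phi s : lip_measurable phi ->
  `|lip_step phi s - phi s| <= EF.
Proof.
move=> phiP.
have ic : Q.-integrable setT (EFin \o cst (phi s)).
  exact: integrable_EFin_cst.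
have is_ := lip_shift_integrable _ s phiP.
have -> : lip_step phi s - phi s = \int[Q]_x (phi (fun j => s j + h j x) - cst (phi s) x).
  rewrite RintegralB//.
  by rewrite Rintegral_probability_cst.
apply: le_trans (le_normr_Rintegral _ _) _ => //.
  exact: integrable_EFinB.
apply: le_Rintegral => //.
  by apply: integrable_EFin_norm; exact: integrable_EFinB.
by move=> x _; exact: lip_shift.
Qed.

Context (lam0 I : R).
Hypothesis lam0_gt0 : 0 < lam0.
Hypothesis expF : (\int[Q]_x (expR (2 * lam0 * (F x + EF)))%:E <= I%:E)%E.

Let C := 4 / lam0 ^+ 2 * I.

(** The increment [D] has mean zero and is bounded by [N = F + EF]. In the Taylor bound one factor
    [expR (lam0 * N)] absorbs [N ^+ 2] and another dominates the exponential remainder, which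
    explains the doubled exponent in [expF]. *)
Lemma lip_step_exp phi s lam : lip_measurable phi -> `|lam| <= lam0 ->
  (\int[Q]_x (expR (lam * phi (fun j => (s j + h j x)%R)))%:E <=
   (expR (lam * lip_step phi s + C * lam ^+ 2))%:E)%E.
Proof.
move=> phiP lamle; have [phi0 phiL phim] := phiP.
set m := lip_step phi s.
have mF : measurable_fun setT F by apply/measurable_EFinP/(measurable_int _ intF).
pose D x := phi (fun j => s j + h j x) - m.
have mphi : measurable_fun setT (fun x => phi (fun j => s j + h j x)).
  by apply: phim => j; exact: measurable_funD.
have mD : measurable_fun setT D by exact: measurable_funB.
have iD : Q.-integrable setT (EFin \o D).
  apply: integrable_EFinB; first exact: lip_shift_integrable.
  exact: integrable_EFin_cst.
pose K := 4 / lam0 ^+ 2 * lam ^+ 2.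
have K0 : 0 <= K by rewrite mulr_ge0// ?sqr_ge0// divr_ge0// sqr_ge0.
pose N x := F x + EF.
have DN x : `|D x| <= N x.
  rewrite /D /N -[_ - m](subrKA (phi s)).
  apply: le_trans (ler_normD _ _) _; apply: lerD; first exact: lip_shift.
  by rewrite distrC; exact: lip_step_dist.
have mE : measurable_fun setT (fun x => expR (2 * lam0 * N x)).
  apply: measurableT_comp => //; apply: measurable_funM => //.
  by apply: measurable_funD.
have pt x : expR (lam * D x) <= 1 + lam * D x + K * expR (2 * lam0 * N x).
  have N0 : 0 <= N x by apply: le_trans (DN x).
  apply: le_trans (expR_le_quadratic _) _; rewrite lerD2l.
  have h1 : (lam * D x) ^+ 2 <= lam ^+ 2 * N x ^+ 2.
    rewrite exprMn ler_wpM2l ?sqr_ge0//.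
    by have := DN x; rewrite ler_norml => /andP[]; nra.
  have h2 : expR `|lam * D x| <= expR (lam0 * N x).
    by rewrite ler_expR normrM ler_pM.
  have h3 : N x ^+ 2 <= 4 / lam0 ^+ 2 * expR (lam0 * N x).
    have := @sqr_le_expR R (lam0 * N x); rewrite exprMn =>
      /(_ (mulr_ge0 (ltW lam0_gt0) N0)) sq.
    by rewrite mulrAC ler_pdivlMr ?exprn_gt0// mulrC.
  have -> : K * expR (2 * lam0 * N x) = lam ^+ 2 * (4 / lam0 ^+ 2 * expR (lam0 * N x)) * expR (lam0 * N x).
    have -> : 2 * lam0 * N x = lam0 * N x + lam0 * N x by ring.
    by rewrite expRD /K; ring.
  apply: ler_pM => //; rewrite ?sqr_ge0 ?expR_ge0//.
  by apply: le_trans h1 _; rewrite ler_wpM2l ?sqr_ge0.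
have iE : Q.-integrable setT (EFin \o (fun x => expR (2 * lam0 * N x))).
  apply/integrableP; split; first exact/measurable_EFinP.
  under eq_integral do rewrite gee0_abs ?lee_fin ?expR_ge0//.
  by apply: le_lt_trans expF _; rewrite ltry.
have iL : Q.-integrable setT (EFin \o (fun x => 1 + lam * D x)).
  apply: integrable_EFinD; first exact: integrable_EFin_cst.
  exact: integrable_EFinZ.
have iKE : Q.-integrable setT (EFin \o (fun x => K * expR (2 * lam0 * N x))).
  exact: integrable_EFinZ.
have bD : (\int[Q]_x (expR (lam * D x))%:E <= (1 + C * lam ^+ 2)%:E)%E.
  apply: (@le_trans _ _ (\int[Q]_x ((1 + lam * D x)%:E + (K * expR (2 * lam0 * N x))%:E))%E).
    apply: ge0_le_integral => //.
    - by apply/measurable_EFinP; apply: measurableT_comp => //; exact: measurable_funM.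
    - by apply: emeasurable_funD; [exact: measurable_int iL|exact: measurable_int iKE].
    - by move=> x _; rewrite -EFinD lee_fin.
  rewrite integralD//.
  (* The linear term vanishes because [m] is the mean of the shifted functional. *)
  have -> : (\int[Q]_x (1 + lam * D x)%:E)%E = 1%E.
    transitivity ((\int[Q]_x (1 + lam * D x))%:E)%E.
      by rewrite /Rintegral fineK//; exact: integrable_fin_num.
    rewrite RintegralD//.
    - rewrite RintegralZl// Rintegral_probability_cst.
      rewrite /D RintegralB//.
      + by rewrite Rintegral_probability_cst subrr mulr0 addr0.
      + exact: lip_shift_integrable.
      + exact: integrable_EFin_cst.
    - exact: integrable_EFin_cst.
    - exact: integrable_EFinZ.
  rewrite EFinD leeD2l//.
  under eq_integral do rewrite EFinM.
  rewrite ge0_integralZl//.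
  - have -> : (C * lam ^+ 2)%:E = (K%:E * I%:E)%E.
      by rewrite -EFinM; congr EFin; rewrite /C /K; ring.
    by apply: lee_pmul => //; apply: integral_ge0 => x _; rewrite lee_fin expR_ge0.
  - exact/measurable_EFinP.
have -> : (\int[Q]_x (expR (lam * phi (fun j => (s j + h j x)%R)))%:E =
  (expR (lam * m))%:E * \int[Q]_x (expR (lam * D x))%:E)%E.
  rewrite -ge0_integralZl//.
  - apply: eq_integral => x _; rewrite -EFinM -expRD /D; congr (expR _)%:E.
    by ring.
  - by apply/measurable_EFinP; apply: measurableT_comp => //; exact: measurable_funM.
rewrite expRD EFinM; apply: lee_wpmul2l; first by rewrite lee_fin expR_ge0.
apply: le_trans bD _; rewrite lee_fin.
exact: expR_ge1Dx.
Qed.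

(** * Exponential moments and tails for functionals of partial sums *)

Context {d0 : measure_display} {Omega : measurableType d0}
  (P : probability Omega R) (X : nat -> Omega -> Z).
Hypothesis mX : forall i, measurable_fun setT (X i).
Hypothesis lawX : forall i A, measurable A -> P (X i @^-1` A) = Q A.
Hypothesis indX : forall (s : seq nat) (A : nat -> set Z), uniq s ->
     (forall i, measurable (A i)) ->
     P (\bigcap_(i in [set i | i \in s]) X i @^-1` A i) =
     (\big[*%E/1%E]_(i <- s) P (X i @^-1` A i))%E.

Definition partial_sum (n : nat) (w : Omega) (j : nat) : R :=
  \sum_(i < n) h j (X i w).

Lemma measurable_partial_sum n j :
  measurable_fun setT (fun w => partial_sum n w j).
Proof.
by apply: measurable_sum => i; exact: measurableT_comp.
Qed.

(* Replacing [X n] by its expectation one step at a time: [phi] becomes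
   [lip_step phi], again Lipschitz, at the cost of a factor [expR (C lam^2)]. *)
Lemma partial_sum_mgf n phi lam : lip_measurable phi -> `|lam| <= lam0 ->
  (\int[P]_w (expR (lam * phi (partial_sum n w)))%:E <=
   (expR (lam * iter n lip_step phi (fun=> 0%R) + C * lam ^+ 2 * n%:R))%:E)%E.
Proof.
move=> + lamle; elim: n phi => [phi phiP|n IH phi phiP].
  rewrite mulr0 addr0 /=.
  under eq_integral => w _.
    rewrite (_ : partial_sum 0 w = fun=> 0); last first.
      by apply/funext => j; rewrite /partial_sum big_ord0.
    over.
  rewrite integral_cst// [X in (_ * X)%E](_ : _ = 1%E) ?mule1//.
  exact: probability_setT.
have [_ _ phim] := phiP.
rewrite iterSr.
have stepP := lip_stepP _ phiP.
have [_ _ stepm] := stepP.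
(* The sum over the first [n] observations is frozen in the first coordinate; it has to be
   measurable for [past X n], and not merely on [Omega], for [integral_indep] to apply. *)
pose f := fun tx : past X n * Z =>
  (expR (lam * phi (fun j => partial_sum n tx.1 j + h j tx.2)))%:E.
have mf : measurable_fun setT f.
  apply/measurable_EFinP; apply: measurableT_comp => //; apply: measurable_funM => //.
  apply: phim => j; apply: measurable_funD; last exact: (measurableT_comp (mh j) measurable_snd).
  apply: (@measurableT_comp _ _ _ _ _ _ (fun w : past X n => partial_sum n w j) _ fst) => //.
  apply: measurable_sum => i.
  by apply: measurableT_comp => //; exact: past_measurable_fun.
have -> : (\int[P]_w (expR (lam * phi (partial_sum n.+1 w)))%:E =
  \int[P]_w f (w, X n w))%E.
  apply: eq_integral => w _; rewrite /f /=; congr (expR (_ * phi _))%:E.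
  by apply/funext => j; rewrite /partial_sum big_ord_recr.
rewrite (@integral_indep _ _ _ _ Omega (past X n) Z P Q id (X n) f)//; last 3 first.
- exact: measurable_fun_past.
- by move=> A B mA mB; rewrite preimage_id -(lawX n)//; exact: past_indep.
- by move=> t; rewrite /f lee_fin expR_ge0.
apply: (@le_trans _ _ (\int[P]_w ((expR (C * lam ^+ 2))%:E *
    (expR (lam * lip_step phi (partial_sum n w)))%:E))%E).
  apply: ge0_le_integral => //.
  - by move=> w _; apply: integral_ge0 => x _; rewrite /f lee_fin expR_ge0.
  - apply: (measurableT_comp (measurable_fun_fubini_tonelli_F _ mf _)).
      by move=> t; rewrite /f lee_fin expR_ge0.
    exact: measurable_fun_past.
  - under eq_fun do rewrite -EFinM.
    apply/measurable_EFinP; apply: measurable_funM => //.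
    apply: measurableT_comp => //; apply: measurable_funM => //.
    apply: stepm => j; exact: measurable_partial_sum.
  - move=> w _; rewrite -EFinM -expRD addrC; exact: (lip_step_exp phi (partial_sum n w)).
rewrite ge0_integralZl//; last first.
- apply/measurable_EFinP.
  apply: measurableT_comp => //; apply: measurable_funM => //.
  apply: stepm => j; exact: measurable_partial_sum.
apply: (@le_trans _ _ ((expR (C * lam ^+ 2))%:E *
    (expR (lam * iter n lip_step (lip_step phi) (fun=> 0) +
       C * lam ^+ 2 * n%:R))%:E)%E).
  by apply: lee_wpmul2l; [rewrite lee_fin expR_ge0|exact: IH].
rewrite -EFinM -expRD lee_fin ler_expR -natr1; lra.
Qed.

(** Markov's inequality for the exponential. Keeping [lam] on both sides of the event treats the
    upper tail ([lam > 0]) and the lower tail ([lam < 0]) together. *)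
Lemma partial_sum_chernoff n phi lam t : lip_measurable phi -> `|lam| <= lam0 ->
  (P [set w | (lam * t <= lam * phi (partial_sum n w))%R] <=
   (expR (lam * (iter n lip_step phi (fun=> 0%R) - t) + C * lam ^+ 2 * n%:R))%:E)%E.
Proof.
move=> phiP lamle; have [_ _ phim] := phiP.
set E := [set w | _].
have mphi : measurable_fun setT (fun w => phi (partial_sum n w)).
  by apply: phim => j; exact: measurable_partial_sum.
have mexp : measurable_fun setT (fun w => (expR (lam * phi (partial_sum n w)))%:E).
  apply/measurable_EFinP; apply: measurableT_comp => //.
  exact: measurable_funM.
have mE : measurable E.
  rewrite -[E]setTI; apply: measurable_fun_le => //.
  exact: measurable_funM.
have bound : ((expR (lam * t))%:E * P E <=
    (expR (lam * iter n lip_step phi (fun=> 0%R) + C * lam ^+ 2 * n%:R))%:E)%E.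
  apply: le_trans (partial_sum_mgf n _ _ phiP lamle).
  rewrite -integral_cst//.
  apply: (@le_trans _ _ (\int[P]_(w in E) (expR (lam * phi (partial_sum n w)))%:E)%E).
    apply: ge0_le_integral => //.
    - by move=> w _; rewrite lee_fin expR_ge0.
    - exact: measurable_funTS.
    - by move=> w Ew; rewrite lee_fin ler_expR.
  exact: ge0_subset_integral.
rewrite -(@lee_pmul2l _ (expR (lam * t))%:E) ?lte_fin ?expR_gt0//.
apply: le_trans bound _.
rewrite -EFinM -expRD lee_fin ler_expR; lra.
Qed.

(* Chernoff at [lam = - 1 / sqrt n]: a center far above [M sqrt n] would
   contradict the tightness hypothesis. *)
Lemma partial_sum_center_le n phi M : lip_measurable phi -> (0 < n)%N ->
  (Num.sqrt n%:R)^-1 <= lam0 ->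
  ((3 / 4)%:E <= P [set w | (phi (partial_sum n w) <= M * Num.sqrt n%:R)%R])%E ->
  iter n lip_step phi (fun=> 0) <= (M + C + 1) * Num.sqrt n%:R.
Proof.
move=> phiP n0 lamle tight; rewrite leNgt; apply/negP => far.
set m := iter _ _ _ _ in far.
set r := Num.sqrt n%:R in lamle tight far.
have r0 : 0 < r by rewrite sqrtr_gt0 ltr0n.
have rr : r ^+ 2 = n%:R by rewrite sqr_sqrtr.
have := @partial_sum_chernoff n phi (- r^-1) (M * r) phiP.
rewrite normrN ger0_norm ?invr_ge0 ?(ltW r0)// => /(_ lamle).
have -> : [set w | - r^-1 * (M * r) <= - r^-1 * phi (partial_sum n w)] =
  [set w | phi (partial_sum n w) <= M * r].
  apply/seteqP; split => w /=; rewrite !mulNr lerN2.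
    by rewrite ler_pM2l// invr_gt0.
  by move=> ?; rewrite ler_pM2l// invr_gt0.
move=> /(le_trans tight); rewrite lee_fin -/m.
have -> : C * (- r^-1) ^+ 2 * n%:R = C.
  by rewrite -rr sqrrN; field; rewrite gt_eqF.
have : - r^-1 * (m - M * r) + C < -1.
  have : M + C + 1 < m / r by rewrite ltr_pdivlMr.
  have -> : - r^-1 * (m - M * r) = M - m / r by field; rewrite gt_eqF.
  lra.
rewrite -ltr_expR => lt1.
(* The exponent lies below -1, so the tight event would have probability at most 1/2, against the
   assumed 3/4. *)
have : expR (-1 : R) <= 1 / 2.
  rewrite expRN ler_pdivlMr// mulrC ler_pdivrMr ?expR_gt0//.
  have := @expR_ge1Dx R 1; lra.
lra.
Qed.

(** Chernoff at [lam = eta * v / n]. The center is at most [c / 2 * v], so the linear term gains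
    [c / 2] times [eta * v ^+ 2 / n]; the quadratic term gives back at most [c / 4] of it. *)
Lemma partial_sum_deviation n phi M c v eta : lip_measurable phi -> (0 < n)%N ->
  (Num.sqrt n%:R)^-1 <= lam0 ->
  ((3 / 4)%:E <= P [set w | (phi (partial_sum n w) <= M * Num.sqrt n%:R)%R])%E ->
  0 < v -> 0 < eta -> eta * v / n%:R <= lam0 -> C * eta <= c / 4 ->
  (M + C + 1) * Num.sqrt n%:R <= c / 2 * v ->
  (P [set w | (c * v <= phi (partial_sum n w))%R] <=
    (expR (- (eta * c / 4) * (v ^+ 2 / n%:R)))%:E)%E.
Proof.
move=> phiP n0 lamle tight v0 eta0 lamle' Ceta cv.
have mle := partial_sum_center_le _ _ _ phiP n0 lamle tight.
set m := iter _ _ _ _ in mle.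
have nR : 0 < n%:R :> R by rewrite ltr0n.
pose lam := eta * v / n%:R.
have lam_gt0 : 0 < lam by rewrite divr_gt0// mulr_gt0.
have := @partial_sum_chernoff n phi lam (c * v) phiP.
rewrite gtr0_norm// => /(_ lamle').
have -> : [set w | lam * (c * v) <= lam * phi (partial_sum n w)] =
  [set w | c * v <= phi (partial_sum n w)].
  by apply/seteqP; split => w /=; rewrite ler_pM2l.
move=> /le_trans; apply; rewrite lee_fin ler_expR -/m.
have -> : C * lam ^+ 2 * n%:R = (C * eta) * (eta * (v ^+ 2 / n%:R)).
  by rewrite /lam; field; rewrite gt_eqF.
have : lam * (m - c * v) <= lam * (- (c / 2 * v)).
  by rewrite ler_pM2l//; lra.
have -> : lam * (- (c / 2 * v)) = - (c / 2) * (eta * (v ^+ 2 / n%:R)).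
  by rewrite /lam; field; rewrite gt_eqF.
have q0 : 0 <= eta * (v ^+ 2 / n%:R).
  by rewrite mulr_ge0 ?(ltW eta0)// divr_ge0 ?sqr_ge0// ltW.
have -> : - (eta * c / 4) * (v ^+ 2 / n%:R) = - (c / 4) * (eta * (v ^+ 2 / n%:R)).
  by field; rewrite gt_eqF.
move: q0 Ceta; set q := eta * _; nra.
Qed.

End lipschitz_step.

(** * Maxima over finitely many coordinates *)

(** Finite maxima stay real and measurable; since their bounds will not depend on [m], a countable
    supremum is reached by monotone limits. *)
Fixpoint maxabs {R : realType} (m : nat) (s : nat -> R) : R :=
  if m is k.+1 then Num.max (maxabs k s) `|s k| else 0.

Lemma maxabs_ge0 {R : realType} m (s : nat -> R) : 0 <= maxabs m s.
Proof. by elim: m => //= m IH; rewrite le_max IH. Qed.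

Lemma ler_maxabs {R : realType} m (s : nat -> R) j : (j < m)%N ->
  `|s j| <= maxabs m s.
Proof.
elim: m => //= m IH; rewrite ltnS leq_eqVlt => /predU1P[->|jm].
  by rewrite le_max lexx orbT.
by rewrite le_max IH.
Qed.

Lemma maxabs_attained {R : realType} m (s : nat -> R) :
  maxabs m s = 0 \/ exists2 j, (j < m)%N & maxabs m s = `|s j|.
Proof.
elim: m => [|m IH]; first by left.
rewrite /=; have [le1|lt1] := leP (maxabs m s) `|s m|.
  by right; exists m.
by case: IH => [->|[j jm ->]]; [left|right; exists j => //; exact: ltnW].
Qed.

Lemma maxabs_nondecreasing {R : realType} m n (s : nat -> R) : (m <= n)%N ->
  maxabs m s <= maxabs n s.
Proof.
move=> mn; have [->|[j jm ->]] := maxabs_attained m s; first exact: maxabs_ge0.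
by apply: ler_maxabs; exact: leq_trans mn.
Qed.

Lemma lip_measurable_maxabs {R : realType} m :
  lip_measurable (@maxabs R m).
Proof.
split.
- exact: maxabs_ge0.
- move=> s s' e ss; have e0 : 0 <= e by apply: le_trans (ss 0%N).
  have [->|[j jm ->]] := maxabs_attained m s.
    by rewrite addr_ge0// maxabs_ge0.
  have -> : s j = s' j + (s j - s' j) by rewrite addrC subrK.
  by apply: le_trans (ler_normD _ _) _; rewrite lerD// ler_maxabs.
- move=> d T g mg; elim: m => [|m IH] /=; first exact: measurable_cst.
  by apply: measurable_maxr => //; exact: measurableT_comp.
Qed.

(** * Continuous surrogates for exceedance of the sup norm *)

Lemma nbhs_uniform_dist {R : realType} {U : choiceType} (g : {uniform U -> R})
  (e : R) (A : set {uniform U -> R}) : 0 < e ->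
  (forall g' : {uniform U -> R}, (forall t, `|g t - g' t| < e) -> A g') -> nbhs g A.
Proof.
move=> e0 gA; apply/uniform_nbhs.
exists [set xy : R * R | ball xy.1 e xy.2].
split; first exact: (entourage_ball _ (PosNum e0)).
by move=> g' /= gg'; apply: gA => t; exact: (gg' t Logic.I).
Qed.

Section soft_exceedance.
Context {R : realType}.

(** A ramp in [|x|], equal to 0 up to [k] and to 1 from [k + 1] on. Weak convergence only tests
    continuous bounded functionals, so it stands in for the indicator of [|x| > k]. *)
Definition clip (k x : R) : R := Num.min 1 (Num.max 0 (`|x| - k)).

Lemma clip_ge0 k x : 0 <= clip k x.
Proof. by rewrite le_min ler01 le_max lexx. Qed.

Lemma clip_le1 k x : clip k x <= 1.
Proof. by rewrite ge_min lexx. Qed.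

Lemma clip_lip k x y : clip k x <= clip k y + `|x - y|.
Proof.
rewrite /clip minEle !maxEle.
have h1 : `|x| <= `|y| + `|x - y|.
  have {1}-> : x = y + (x - y) by rewrite addrC subrK.
  exact: ler_normD.
have := normr_ge0 (x - y).
by case: ifPn; case: ifPn => ?; rewrite minEle; case: ifPn; case: ifPn; rewrite -?ltNge; lra.
Qed.

Lemma clip_eq0 k x : `|x| <= k -> clip k x = 0.
Proof.
by move=> xk; rewrite /clip max_l ?min_r// subr_le0.
Qed.

Lemma clip_eq1 k x : k + 1 <= `|x| -> clip k x = 1.
Proof.
move=> xk; rewrite /clip min_l// le_max; apply/orP; right; lra.
Qed.

Context {U : choiceType} (u0 : U).

Definition exceedance (k : R) (g : {uniform U -> R}) : R :=
  sup (range (fun t => clip k (g t))).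

Lemma has_sup_clip k (g : U -> R) : has_sup (range (fun t => clip k (g t))).
Proof.
split; first by exists (clip k (g u0)), u0.
by exists 1 => _ [t _ <-]; exact: clip_le1.
Qed.

Lemma exceedance_ub k (g : {uniform U -> R}) t : clip k (g t) <= exceedance k g.
Proof. by apply: sup_upper_bound; [exact: has_sup_clip|exists t]. Qed.

Lemma exceedance_le k (g : {uniform U -> R}) b :
  (forall t, clip k (g t) <= b) -> exceedance k g <= b.
Proof.
move=> gb; apply: ge_sup; first by case: (has_sup_clip k g).
by move=> _ [t _ <-].
Qed.

Lemma exceedance_ge0 k g : 0 <= exceedance k g.
Proof. exact: le_trans (clip_ge0 k (g u0)) (exceedance_ub k g u0). Qed.

Lemma exceedance_le1 k g : exceedance k g <= 1.
Proof. by apply: exceedance_le => t; exact: clip_le1. Qed.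

Lemma continuous_exceedance k : continuous (exceedance k).
Proof.
move=> g A /nbhs_ballP[e /= e0 eA].
(* Half of [e] is used because passing to the supremum turns strict inequalities into weak ones. *)
have e20 : 0 < e / 2 by rewrite divr_gt0.
apply: (nbhs_uniform_dist g (e / 2)) => // g' gg'; apply: eA.
apply: (@le_lt_trans _ _ (e / 2)); last by rewrite ltr_pdivrMr// ltr_pMr// ltr1n.
rewrite ler_norml; apply/andP; split.
  rewrite lerBrDr addrC lerBlDr.
  apply: exceedance_le => t; apply: le_trans (clip_lip k (g' t) (g t)) _.
  by apply: lerD; [exact: exceedance_ub|rewrite distrC; exact: ltW].
rewrite lerBlDl.
apply: exceedance_le => t; apply: le_trans (clip_lip k (g t) (g' t)) _.
by apply: lerD; [exact: exceedance_ub|exact: ltW].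
Qed.

Definition exceeds (k : R) : set {uniform U -> R} :=
  [set g | exists t, k < `|g t|].

Lemma open_exceeds (k : R) :
  open (exceeds k).
Proof.
rewrite openE => g [t kt].
have e0 : 0 < `|g t| - k by rewrite subr_gt0.
apply: (nbhs_uniform_dist g _ _ e0) => g' gg' /=.
exists t; have := gg' t.
have : `|g t| <= `|g' t| + `|g t - g' t|.
  have {1}-> : g t = g' t + (g t - g' t) by rewrite addrC subrK.
  exact: ler_normD.
lra.
Qed.

Lemma exceedance_le_indic (k : R) g : exceedance k g <= \1_(exceeds k) g.
Proof.
rewrite indicE; case: (pselect (exists t, k < `|g t|)) => [ex|nex].
  by rewrite mem_set// exceedance_le1.
rewrite memNset//; apply: exceedance_le => t; rewrite clip_eq0//.
by rewrite leNgt; apply/negP => kt; apply: nex; exists t.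
Qed.

End soft_exceedance.

(** * Tightness of the empirical process from the Donsker property *)

Section tightness.
Context {R : realType} {Z : completePseudoMetricType R}
  {d0 : measure_display} {Omega : measurableType d0}
  (P : probability Omega R) (X : nat -> Omega -> Borel Z)
  (mu : {measure set (Borel Z) -> \bar R}) (pstar : Z -> R) (F : set (Z -> R)).

Definition centered (f : nat -> Z -> R) (j : nat) (x : Borel Z) : R :=
  f j x - fine (dexp mu pstar (f j)).

(** The comparison is made with each measurable majorant [W], since [Y] itself, a supremum over the
    class, may fail to be measurable. *)
Lemma le_oexp (E : set Omega) (Y : Omega -> R) : measurable E ->
  (forall w, \1_E w <= Y w) -> (P E <= oexp P Y)%E.
Proof.
move=> mE EY; apply: le_ereal_inf_tmp => _ [W [mW YW] <-].
rewrite -[E in P E]setIT -integral_indic//.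
apply: ge0_le_integral => //.
- by apply/measurable_EFinP.
- by apply/measurable_EFinP.
- by move=> w _; rewrite lee_fin; exact: le_trans (EY w) (YW w).
Qed.

(** Every path of [G] is bounded, so these events decrease to the empty set, and continuity from
    above applies. *)
Lemma uniform_exceedance_cvg0 {d' : measure_display} {Omega' : measurableType d'}
  (P' : probability Omega' R) (G : Omega' -> {uniform fclass F -> R}) :
  (forall w, linf_bounded (G w)) ->
  (forall V : set {uniform fclass F -> R}, open V -> measurable (G @^-1` V)) ->
  P' (G @^-1` (exceeds k%:R)) @[k --> \oo] --> 0%E.
Proof.
move=> bG mG.
have mE k : measurable (G @^-1` (exceeds k%:R)).
  by apply: mG; exact: open_exceeds.
have I0 : \bigcap_k (G @^-1` (exceeds k%:R)) = set0.
  apply/seteqP; split => // w /= H.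
  have [M HM] := bG w.
  have [t] := H (Num.truncn M).+1 I.
  rewrite ltNge => /negP; apply; apply: le_trans (HM t) _.
  by apply: ltW; exact: truncnS_gt.
have := @nonincreasing_cvg_mu _ _ _ P' (fun k => G @^-1` (exceeds k%:R)).
rewrite I0 measure0; apply => //.
- by rewrite ltey_eq fin_num_measure.
- move=> a b ab; apply/subsetPset => w [t /= bt]; exists t.
  by apply: le_lt_trans bt; rewrite ler_nat.
Qed.

(** For a suitable [k] the limit exceeds level [k] with probability below 1/8. Weak convergence
    tested on [exceedance k] then keeps the outer expectation below 1/4 for large [n], and it
    dominates the exceedance probability of any finite selection. The threshold on [n] is thus
    uniform in [f] and [m]. *)
Lemma donsker_tight (f0 : fclass F) : donsker P X mu pstar F ->
  exists M : R, \forall n \near \oo, forall (f : nat -> Z -> R) (m : nat),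
    (forall j, F (f j)) ->
    (forall j, measurable_fun setT (fun w => partial_sum (centered f) X n w j)) ->
    ((3 / 4)%:E <= P [set w |
      (maxabs m (partial_sum (centered f) X n w) <= M * Num.sqrt n%:R)%R])%E.
Proof.
case=> d1 [Om1 [P1 [G [bG [mG [_ cvgG]]]]]].
have e8 : (0 < (8^-1 : R)%:E)%E by rewrite lte_fin invr_gt0.
have [k Pk] : exists k : nat, (P1 (G @^-1` (exceeds k%:R)) < (8^-1 : R)%:E)%E.
  have := uniform_exceedance_cvg0 P1 G bG mG.
  move=> /(_ [set x | x < (8^-1 : R)%:E]%E).
  case; first by apply: open_nbhs_nbhs; split => //; exact: open_ereal_lt_ereal.
  by move=> N _ /(_ N (leqnn N)) h; exists N.
(* [clip k] reaches the value 1 only at [k + 1]. *)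
exists (k%:R + 1).
have cexc := @continuous_exceedance R (fclass F) f0 k%:R.
have exc01 (g : {uniform fclass F -> R}) : `|exceedance k%:R g| <= 1.
  by rewrite ger0_norm ?exceedance_ge0// exceedance_le1.
have /(cvgG _ (continuous_subspaceT cexc)) : exists M : R,
    forall g : {uniform fclass F -> R}, linf_bounded g -> `|exceedance k%:R g| <= M.
  by exists 1.
have limle : (\int[P1]_w (exceedance k%:R (G w))%:E < (4^-1 : R)%:E)%E.
  apply: (@le_lt_trans _ _ (P1 (G @^-1` (exceeds k%:R)))); last first.
    by apply: (lt_le_trans Pk); rewrite lee_fin; lra.
  have mU : measurable (G @^-1` (exceeds k%:R)).
    by apply: mG; exact: open_exceeds.
  rewrite -[X in (_ <= P1 X)%E]setIT -integral_indic//.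
  apply: ge0_le_integral => //.
  - by move=> w _; rewrite lee_fin exceedance_ge0.
  - apply/measurable_EFinP; apply: (measurability _ (RGenOpens.measurableE R)).
    move=> _ [_ [a [b ->]] <-]; rewrite setTI.
    apply: (mG (exceedance k%:R @^-1` `]a, b[%classic)).
    by move/continuousP : cexc; apply; exact: interval_open.
  - by apply/measurable_EFinP.
  - by move=> w _; rewrite lee_fin; exact: exceedance_le_indic.
move=> /(_ [set x | x < (4^-1 : R)%:E]%E).
case; first by apply: open_nbhs_nbhs; split => //; exact: open_ereal_lt_ereal.
move=> N _ HN; exists N.+1 => // n /= Nn f m Ff mf.
set S := partial_sum _ X n.
have n0 : (0 < n)%N by exact: leq_ltn_trans Nn.
have r0 : 0 < Num.sqrt (n%:R : R) by rewrite sqrtr_gt0 ltr0n.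
set L := [set w | _].
have mS : measurable_fun setT (fun w => maxabs m (S w)).
  by have [_ _ mm] := @lip_measurable_maxabs R m; apply: mm => j; exact: mf.
have mL : measurable L.
  by rewrite -[L]setTI; apply: measurable_fun_le.
have mE : measurable (~` L) by exact: measurableC.
have PE : (P (~` L) <= (4^-1 : R)%:E)%E.
  apply: le_trans (ltW (HN n (ltnW Nn))).
  apply: le_oexp => // w; rewrite indicE.
  case: (boolP (w \in ~` L)) => [|_]; last by rewrite exceedance_ge0.
  rewrite inE /L /= => /negP; rewrite -ltNge => kS.
  have [S0|[j jm Sj]] := maxabs_attained m (S w).
    exfalso; move: kS; rewrite S0 ltNge => /negP; apply.
    by rewrite mulr_ge0// ?addr_ge0// ltW.
  apply: le_trans (exceedance_ub f0 k%:R (emp_proc X mu pstar n w) (exist _ _ (Ff j))).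
  rewrite clip_eq1// /emp_proc /= normrM gtr0_norm ?invr_gt0//.
  rewrite mulrC ler_pdivlMr//.
  by move: kS; rewrite Sj /S /partial_sum => /ltW.
have Pf : P L \is a fin_num by exact: fin_num_measure.
move: PE; rewrite probability_setC// -(fineK Pf) -EFinB !lee_fin; lra.
Qed.

End tightness.

(** * Densities, dense sequences and limit superior *)

(** By sigma-finiteness [f] agrees almost everywhere with the Radon-Nikodym derivative of [nu], for
    which the change of variables is known. *)
Lemma ge0_integral_density {R : realType} {d : measure_display}
  {T : measurableType d} (mu : {measure set T -> \bar R}) (nu : probability T R)
  (f g : T -> R) : sigma_finite setT mu ->
  measurable_fun setT f -> (forall x, 0 <= f x) ->
  (forall A, measurable A -> nu A = (\int[mu]_(x in A) (f x)%:E)%E) ->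
  measurable_fun setT g -> (forall x, 0 <= g x) ->
  (\int[nu]_x (g x)%:E = \int[mu]_x (g x * f x)%:E)%E.
Proof.
move=> smu mf f0 nuE mg g0.
pose smuP := isSigmaFinite.Build _ _ _ (Measure.sort mu) smu.
pose sfmuP := isSFinite.Build _ _ _ (Measure.sort mu) (sfinite_measure_sigma_finite smu).
pose mu' : {sigma_finite_measure set T -> \bar R} :=
  HB.pack_for (SigmaFiniteMeasure.type T R) (Measure.sort mu) smuP sfmuP.
have numu : nu `<< mu'.
  apply/null_content_dominatesP => A mA muA; rewrite nuE//.
  by apply: null_set_integral => //; apply/measurable_funTS/measurable_EFinP.
have rnE := Radon_Nikodym_SigmaFinite.f_integral numu.
have rni := Radon_Nikodym_SigmaFinite.f_integrable numu.
have ae : ae_eq mu' setT (Radon_Nikodym_SigmaFinite.f nu mu') (EFin \o f).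
  apply: integral_ae_eq => //; first exact/measurable_EFinP.
  by move=> A _ mA; exact: etrans (esym (rnE _ mA)) (nuE _ mA).
rewrite -(Radon_Nikodym_SigmaFinite.change_of_variables numu)//; last first.
  exact/measurable_EFinP.
under [RHS]eq_integral do rewrite EFinM.
apply: (ae_eq_integral (mu := mu')) => //.
- apply: emeasurable_funM; first exact/measurable_EFinP.
  exact: measurable_int rni.
- by apply: emeasurable_funM; exact/measurable_EFinP.
- by apply: filterS ae => x /= h _; rewrite h.
Qed.

(** Compactness gives a finite net of radius [1 / (k + 1)] for each [k]; the union of these nets is
    enumerated. *)
Lemma compact_dense_sequence {R : realType} {T : pseudoMetricType R}
  (A : set T) (x0 : T) : compact A -> A x0 ->
  exists s : nat -> T, (forall j, A (s j)) /\
    (forall x e, A x -> 0 < e -> exists j, ball x e (s j)).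
Proof.
move=> cA Ax0.
pose pT : ptopologicalType := HB.pack (PseudoMetric.sort T) (isPointed.Build T x0).
have {}cA : @cover_compact pT A by rewrite -compact_cover.
have net (k : nat) : exists D : seq T, (forall x, x \in D -> A x) /\
    forall x, A x -> exists2 y, y \in D & ball y k.+1%:R^-1 x.
  case: (cA T A (fun x => (ball x k.+1%:R^-1)°)).
  - by move=> x _; exact: open_interior.
  - move=> x Ax; exists x => //; apply: nbhsx_ballx.
    by rewrite invr_gt0 ltr0n.
  - move=> D DA AD; exists (finmap.enum_fset D); split.
      by move=> x xD; apply/set_mem/DA.
    move=> x /AD[y /= yD /interior_subset yx].
    by exists y.
pose D k := projT1 (cid (net k)).
have DP k : (forall x, x \in D k -> A x) /\
    forall x, A x -> exists2 y, y \in D k & ball y k.+1%:R^-1 x.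
  by rewrite /D; case: cid.
(* The integer [n] codes a pair (net, position); invalid codes default to [x0], which also lies in
   [A]. *)
exists (fun n => if unpickle n is Some (k, i) then nth x0 (D k) i else x0).
split.
  move=> j; case: unpickle => // -[k i].
  have [isz|isz] := ltnP i (size (D k)); last by rewrite nth_default.
  by apply: (DP k).1; exact: mem_nth.
move=> x e Ax e0.
have [k ke] : exists k : nat, k.+1%:R^-1 < e.
  exists (Num.truncn e^-1); rewrite invf_plt ?posrE ?ltr0n//.
  exact: truncnS_gt.
have [y yD xy] := (DP k).2 x Ax.
exists (pickle (k, index y (D k))); rewrite pickleK nth_index//.
by apply: (@le_ball _ _ _ k.+1%:R^-1); [exact: ltW|exact: ball_sym].
Qed.

(** A strict inequality is an open condition, so it is inherited by some point of the dense
    sequence. *)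
Lemma within_continuous_gt_dense {R : realType} {T : pseudoMetricType R}
  (A : set T) (f : T -> R) (s : nat -> T) (x : T) (y : R) :
  {within A, continuous f} -> (forall j, A (s j)) ->
  (forall e, 0 < e -> exists j, ball x e (s j)) -> A x -> y < f x ->
  exists j, y < f (s j).
Proof.
move=> /subspace_continuousP cf As ds Ax yf.
have /cvgr_gt/(_ y yf) := cf x Ax.
rewrite /prop_near1 /within /= => /nbhs_ballP[e /= e0 eA].
by have [j xj] := ds e e0; exists j; exact: eA.
Qed.

Lemma within_continuous_sum {R : realType} {T : topologicalType}
  (A : set T) (n : nat) (f : 'I_n -> T -> R) :
  (forall i, {within A, continuous (f i)}) ->
  {within A, continuous (fun x => \sum_(i < n) f i x)}.
Proof.
move=> cf; elim: n f cf => [|n IH] f cf.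
  under eq_fun do rewrite big_ord0; move=> x; exact: cvg_cst.
under eq_fun do rewrite big_ord_recr.
move=> x; apply: cvgD; first exact: IH.
exact: cf.
Qed.

Lemma limn_esup_lt0 {R : realType} (u : nat -> \bar R) (k : R) : 0 < k ->
  (\forall n \near \oo, (u n <= (- k)%:E)%E) -> (limn_esup u < 0)%E.
Proof.
move=> k0 [N _ uN]; apply: (@le_lt_trans _ _ (- k)%:E); last first.
  by rewrite lte_fin oppr_lt0.
apply: (@le_trans _ _ (ereal_sup (u @` [set n | (N <= n)%N]))).
  apply: ereal_inf_lbound.
  by exists [set n | (N <= n)%N] => //; exists N.
by apply: ge_ereal_sup => _ [n Nn <-]; exact: uN.
Qed.

(** Converts a finite [tau] moment into an exponential one: the difference of the two sides is
    [expR s - 2 * s + 2], at least [(s / 2 - 1) ^+ 2 + 2]. *)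
Lemma expR_le_tau {R : realType} (s : R) : 0 <= s -> expR s <= 2 * tau s + 4.
Proof.
move=> s0; rewrite /tau ger0_norm//.
have : 1 + s + s ^+ 2 / 4 <= expR s.
  have -> : expR s = expR (s / 2) ^+ 2.
    by rewrite expr2 -expRD; congr expR; lra.
  have -> : 1 + s + s ^+ 2 / 4 = (1 + s / 2) ^+ 2 by field.
  by rewrite ler_pXn2r ?nnegrE ?expR_ge0 ?expR_ge1Dx// addr_ge0// divr_ge0.
have := sqr_ge0 (s / 2 - 1); lra.
Qed.

(** * Log-likelihood ratios under the true density *)

Section true_density.
Context {R : realType} {Z : completePseudoMetricType R}
  (mu : {measure set (Borel Z) -> \bar R}) (pstar l u : Z -> R).
Hypothesis dpstar : is_density mu pstar.
Hypothesis pstar_lu : forall x, 0 < pstar x /\ l x <= ln (pstar x) <= u x.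
Hypothesis mul : measurable_fun [set: Borel Z] ((u \- l) : Borel Z -> R).
Hypothesis iul : (dexp mu pstar (fun x => `|u x - l x|%R) < +oo)%E.

Lemma density_integrable (q : Z -> R) : is_density mu q ->
  mu.-integrable [set: Borel Z] (EFin \o (q : Borel Z -> R)).
Proof.
move=> [mq [q0 q1]]; apply/integrableP; split; first exact/measurable_EFinP.
under eq_integral do rewrite gee0_abs ?lee_fin//.
by rewrite q1 ltry.
Qed.

Section log_ratio.
Context (q : Z -> R).
Hypothesis dq : is_density mu q.
Hypothesis q_lu : forall x, 0 < q x /\ l x <= ln (q x) <= u x.

Lemma log_ratio_measurable :
  measurable_fun [set: Borel Z] (fun z : Borel Z => ln (q z) - ln (pstar z)).
Proof.
have [mq _] := dq; have [mp _] := dpstar.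
by apply: measurable_funB; apply: measurableT_comp => //; exact: measurable_ln.
Qed.

Lemma log_ratio_le x : `|ln (q x) - ln (pstar x)| <= u x - l x.
Proof.
have [_ /andP[h1 h2]] := q_lu x; have [_ /andP[h3 h4]] := pstar_lu x.
by rewrite ler_norml; apply/andP; split; lra.
Qed.

Lemma log_ratio_integrable : mu.-integrable [set: Borel Z]
  (fun z : Borel Z => ((ln (q z) - ln (pstar z)) * pstar z)%:E).
Proof.
have [mp _] := dpstar.
apply/integrableP; split.
  apply/measurable_EFinP; apply: measurable_funM => //.
  exact: log_ratio_measurable.
apply: le_lt_trans iul; apply: ge0_le_integral => //.
- apply: measurableT_comp => //; apply/measurable_EFinP.
  by apply: measurable_funM => //; exact: log_ratio_measurable.
- apply/measurable_EFinP; apply: measurable_funM => //.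
  by apply: measurableT_comp => //.
- move=> x _ /=; rewrite lee_fin normrM (gtr0_norm (pstar_lu x).1).
  rewrite ler_wpM2r ?(ltW (pstar_lu x).1)//.
  exact: le_trans (log_ratio_le x) (ler_norm _).
Qed.

(* Gibbs' inequality, from [ln y <= y - 1] at [y = q / pstar]. *)
Lemma dexp_log_ratio_le0 :
  fine (dexp mu pstar (fun z => ln (q z) - ln (pstar z))) <= 0.
Proof.
have [mp [p0 p1]] := dpstar; have [mq [q0 q1]] := dq.
have il := log_ratio_integrable.
have ip := density_integrable _ dpstar; have iq := density_integrable _ dq.
have -> : 0 = fine (\int[mu]_x (q x - pstar x)%:E)%E :> R.
  by rewrite integralB_EFin// q1 p1 subee.
rewrite /dexp fine_le//.
- exact: integrable_fin_num.
- by apply: integrable_fin_num => //; exact: (integrable_EFinB mu _ _ iq ip).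
apply: le_integral => //; first exact: (integrable_EFinB mu _ _ iq ip).
move=> x _; rewrite lee_fin.
have [qx _] := q_lu x; have [px _] := pstar_lu x.
have : ln (q x / pstar x) <= q x / pstar x - 1.
  rewrite -ler_expR lnK ?posrE ?divr_gt0//.
  by have := expR_ge1Dx (q x / pstar x - 1); rewrite addrC subrK.
rewrite ln_div ?posrE// => h.
have -> : q x - pstar x = (q x / pstar x - 1) * pstar x.
  by rewrite mulrBl divfK ?gt_eqF// mul1r.
by rewrite ler_wpM2r// ltW.
Qed.

Lemma norm_dexp_log_ratio : `|fine (dexp mu pstar (fun z => ln (q z) - ln (pstar z)))| <=
  fine (dexp mu pstar (fun x => `|u x - l x|)).
Proof.
have [mp _] := dpstar.
have il := log_ratio_integrable.
have := le_normr_Rintegral measurableT il.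
rewrite /Rintegral /dexp => /le_trans; apply.
apply: fine_le => //.
- apply: integrable_fin_num => //.
  exact: (integrable_EFin_norm mu _ il).
- rewrite ge0_fin_numE//; apply: integral_ge0 => x _.
  by rewrite lee_fin mulr_ge0// ltW// (pstar_lu x).1.
apply: ge0_le_integral => //.
- apply/measurable_EFinP; apply: measurableT_comp => //.
  by apply: measurable_funM => //; exact: log_ratio_measurable.
- by apply/measurable_EFinP; apply: measurable_funM => //; apply: measurableT_comp.
- move=> x _ /=; rewrite lee_fin normrM (gtr0_norm (pstar_lu x).1).
  rewrite ler_wpM2r ?(ltW (pstar_lu x).1)//.
  exact: le_trans (log_ratio_le x) (ler_norm _).
Qed.

(** Equal laws force the densities to agree [mu]-almost everywhere; hence observations almost surely
    avoid the points where they differ. *)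
Lemma same_law_null : same_law mu q pstar ->
  measurable ([set x | q x != pstar x] : set (Borel Z)) /\
  dmeas mu pstar [set x | q x != pstar x] = 0%E.
Proof.
move=> qp; have [mp _] := dpstar; have [mq _] := dq.
have mN : measurable ([set x | q x != pstar x] : set (Borel Z)).
  have := @measurable_neqe _ (Borel Z) R setT measurableT
    (fun x => (q x)%:E) (fun x => (pstar x)%:E).
  rewrite setTI; apply; exact/measurable_EFinP.
split => //.
have ae : ae_eq mu [set: Borel Z] (EFin \o (q : Borel Z -> R)) (EFin \o (pstar : Borel Z -> R)).
  apply: integral_ae_eq => //; first exact: density_integrable.
    exact/measurable_EFinP.
  by move=> E _ mE; exact: qp.
apply: null_set_integral => //.
  by apply/measurable_funTS/measurable_EFinP.
apply/negligibleP => //; apply: negligibleS ae.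
by move=> x /= /eqP qx; apply: contra_not qx => /(_ Logic.I)[].
Qed.

End log_ratio.
End true_density.

(** * Exponential bound for the overfitting event *)

Section deviation.
Context {R : realType} {Z : completePseudoMetricType R}
  (mu : {measure set (Borel Z) -> \bar R}) (pstar l u : Z -> R).
Hypothesis smu : sigma_finite [set: Borel Z] mu.
Hypothesis dpstar : is_density mu pstar.
Hypothesis pstar_lu : forall x, 0 < pstar x /\ l x <= ln (pstar x) <= u x.
Hypothesis mul : measurable_fun [set: Borel Z] ((u \- l) : Borel Z -> R).
Hypothesis iul : (dexp mu pstar (fun x => `|u x - l x|%R) < +oo)%E.
Hypothesis tul : in_Ltau mu pstar (u \- l).

Context {Theta : pseudoMetricType R} (A : set Theta) (p : Theta -> Z -> R)
  (ths : Theta).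
Hypothesis cA : compact A.
Hypothesis dp : forall th, A th -> is_density mu (p th).
Hypothesis p_lu : forall th, A th -> forall x, 0 < p th x /\ l x <= ln (p th x) <= u x.
Hypothesis cp : forall z : Z, {within A, continuous (fun th => ln (p th z))}.
Hypothesis Aths : A ths.
Hypothesis ths_law : same_law mu (p ths) pstar.

Context {d0 : measure_display} {Omega : measurableType d0}
  (P : probability Omega R) (X : nat -> Omega -> Borel Z).
Hypothesis iidX : iid P X (dmeas mu pstar).
Hypothesis dons : donsker P X mu pstar [set f : Z -> R | exists2 th, A th &
  f = (fun z => ln (p th z) - ln (pstar z))].

Context (v : nat -> R) (c : R).
Hypothesis v_gt0 : forall n, (0 < n)%N -> 0 < v n.
Hypothesis vo : (fun n => v n / n%:R) @ \oo --> 0.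
Hypothesis v2 : (fun n => n%:R / (v n ^+ 2)) @ \oo --> 0.
Hypothesis c_gt0 : 0 < c.

Definition overfit (n : nat) : set Omega :=
  [set w | exists2 th, A th & loglik X p n ths w + c * v n < loglik X p n th w].

(** [overfit n] is a possibly uncountable union, so the bound is stated for its measurable subsets.
    Up to a null set they lie in a countable union of events about [maxabs] over a dense sequence of
    parameters. *)
Lemma overfit_deviation : exists2 k : R, 0 < k &
  \forall n \near \oo, forall E : set Omega, measurable E -> E `<=` overfit n ->
    (P E <= (expR (- k * (v n ^+ 2 / n%:R)))%:E)%E.
Proof.
have [mX [lawX indX]] := iidX.
pose X0 : {mfun Omega >-> Borel Z} := HB.pack (X 0%N) (isMeasurableFun.Build _ _ _ _ _ (mX 0%N)).
pose Q : probability (Borel Z) R := distribution P X0.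
have QE B : measurable B -> Q B = dmeas mu pstar B.
  exact: (lawX 0%N).
have XQ i B : measurable B -> P (X i @^-1` B) = Q B.
  by move=> mB; rewrite lawX// QE.
have [mp [p0 p1]] := dpstar.
have dens (g : Borel Z -> R) : measurable_fun setT g -> (forall x, 0 <= g x) ->
  (\int[Q]_x (g x)%:E = dexp mu pstar g)%E.
  by move=> mg g0; apply: ge0_integral_density.
have [s [As sd]] := compact_dense_sequence _ _ cA Aths.
pose f (j : nat) (z : Z) := ln (p (s j) z) - ln (pstar z).
pose h := centered mu pstar f.
pose B := fine (dexp mu pstar (fun x => `|u x - l x|)).
have ul0 x : 0 <= u x - l x by have [_ /andP[h1 h2]] := pstar_lu x; lra.
(* Envelope of the centered ratios: [u - l] bounds the ratio and [B] bounds its mean. *)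
pose F (x : Borel Z) := (u x - l x) + B.
have mh j : measurable_fun setT (h j).
  apply: measurable_funB => //.
  exact: log_ratio_measurable dpstar _ (dp _ (As j)).
have hF j x : `|h j x| <= F x.
  apply: le_trans (ler_normB _ _) _; apply: lerD.
    exact: log_ratio_le pstar_lu _ (p_lu _ (As j)) x.
  exact: norm_dexp_log_ratio dpstar pstar_lu mul iul _ (dp _ (As j)) (p_lu _ (As j)).
have iulQ : Q.-integrable setT (EFin \o (fun x : Borel Z => u x - l x)).
  apply/integrableP; split; first exact/measurable_EFinP.
  under eq_integral do rewrite -[`| _ |%E]/((`|u _ - l _|)%:E).
  by rewrite dens//; exact: measurableT_comp.
have intF : Q.-integrable setT (EFin \o F).
  by apply: integrable_EFinD => //; exact: integrable_EFin_cst.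
pose EF := \int[Q]_x F x.
have [a a0 ta] := tul.
have mtau : measurable_fun [set: Borel Z] (fun x : Borel Z => tau ((u x - l x) / a)).
  have mn : measurable_fun [set: Borel Z] (fun x : Borel Z => `|(u x - l x) / a|).
    by apply: measurableT_comp => //; exact: measurable_funM.
  apply: measurable_funB => //; apply: measurable_funB => //.
  exact: measurableT_comp.
have tau_ge0 (x : R) : 0 <= tau x by rewrite /tau; have := expR_ge1Dx `|x|; lra.
pose T := fine (dexp mu pstar (fun x => tau ((u x - l x) / a))).
have TE : (\int[Q]_x (tau ((u x - l x) / a))%:E = T%:E)%E.
  rewrite dens// /T fineK// ge0_fin_numE//.
  by apply: integral_ge0 => x _; rewrite lee_fin mulr_ge0.
have T0 : 0 <= T.
  by apply: fine_ge0; apply: integral_ge0 => x _; rewrite lee_fin mulr_ge0.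
(* With this choice [2 * lam0 * (F + EF)] is [(u - l) / a] plus a constant, exactly what [in_Ltau]
   controls. *)
pose lam0 := (2 * a)^-1.
have lam00 : 0 < lam0 by rewrite invr_gt0 mulr_gt0.
pose I := expR ((B + EF) / a) * (2 * T + 4).
have I0 : 0 <= I by rewrite mulr_ge0 ?expR_ge0// addr_ge0// mulr_ge0.
have expF : (\int[Q]_x (expR (2 * lam0 * (F x + EF)))%:E <= I%:E)%E.
  have pt x : expR (2 * lam0 * (F x + EF)) <=
      expR ((B + EF) / a) * (2 * tau ((u x - l x) / a) + 4).
    have -> : 2 * lam0 * (F x + EF) = (B + EF) / a + (u x - l x) / a.
      by rewrite /lam0 /F; field; rewrite gt_eqF.
    rewrite expRD ler_wpM2l ?expR_ge0//.
    by apply: expR_le_tau; rewrite divr_ge0// ltW.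
  apply: (@le_trans _ _ (\int[Q]_x ((expR ((B + EF) / a))%:E *
      (2%:E * (tau ((u x - l x) / a))%:E + 4%:E)))%E).
    apply: ge0_le_integral => //.
    - apply/measurable_EFinP; apply: measurableT_comp => //.
      apply: measurable_funM => //; apply: measurable_funD => //.
      exact: measurable_funD.
    - apply: emeasurable_funM => //; apply: emeasurable_funD => //.
      by apply: emeasurable_funM => //; exact/measurable_EFinP.
    - by move=> x _; have := pt x; rewrite -lee_fin.
  rewrite ge0_integralZl//; last 2 first.
  - apply: emeasurable_funD => //.
    by apply: emeasurable_funM => //; exact/measurable_EFinP.
  - by move=> x _; rewrite adde_ge0// mule_ge0// lee_fin.
  rewrite ge0_integralD//; last 2 first.
  - by move=> x _; rewrite mule_ge0// lee_fin.
  - by apply: emeasurable_funM => //; exact/measurable_EFinP.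
  rewrite ge0_integralZl//; last 2 first.
  - exact/measurable_EFinP.
  - by move=> x _; rewrite lee_fin.
  rewrite TE integral_cst// [X in (4%:E * X)%E](_ : _ = 1%E) ?mule1//.
  exact: probability_setT.
pose C := 4 / lam0 ^+ 2 * I.
have C0 : 0 <= C by rewrite mulr_ge0// divr_ge0// sqr_ge0.
have Ff j : [set f : Z -> R | exists2 th, A th &
  f = (fun z => ln (p th z) - ln (pstar z))] (f j) by exists (s j).
have [M tight] := donsker_tight P X mu pstar _ (exist _ _ (Ff 0%N)) dons.
(* Chosen so that [C * eta <= c / 4]; the added 1 makes the denominator positive even if [C = 0]. *)
pose eta := c / (4 * (C + 1)).
have eta0 : 0 < eta by rewrite divr_gt0// mulr_gt0// ltr_pwDr.
have Ceta : C * eta <= c / 4.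
  have -> : c / 4 = (C + 1) * eta by rewrite /eta; field; rewrite gt_eqF// ltr_pwDr.
  by rewrite ler_wpM2r ?ltW// ltrDl.
exists (eta * c / 4); first by rewrite divr_gt0// mulr_gt0.
pose M' := `|M| + C + 1.
have M'0 : 0 < M' by rewrite ltr_pwDr// addr_ge0.
(* Large [n] makes both Chernoff parameters admissible ([S2] and [S3]), while [S4], after taking
   square roots, gives [M' * sqrt n <= c / 2 * v n]. *)
have S1 : \forall n \near \oo, (0 < n)%N by exists 1%N.
have S2 : \forall n \near \oo, lam0^-1 ^+ 2 <= n%:R by exact: nbhs_infty_ger.
have S3 : \forall n \near \oo, v n / n%:R < lam0 / eta.
  by apply: (cvgr_lt _ vo); rewrite divr_gt0.
have S4 : \forall n \near \oo, n%:R / v n ^+ 2 < (c / (2 * M')) ^+ 2.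
  by apply: (cvgr_lt _ v2); rewrite exprn_gt0// divr_gt0// mulr_gt0.
near=> n => E mE Edev.
have n0 : (0 < n)%N by near: n.
have nR : 0 < n%:R :> R by rewrite ltr0n.
have vn := v_gt0 n n0.
set S := partial_sum h X n.
have bound m : (P [set w | (c * v n <= maxabs m (S w))%R] <=
    (expR (- (eta * c / 4) * (v n ^+ 2 / n%:R)))%:E)%E.
  apply: (@partial_sum_deviation R _ (Borel Z) Q h F mh intF hF lam0 I lam00
    expF _ Omega P X mX XQ indX n (maxabs m) M c (v n) eta) => //.
  - exact: lip_measurable_maxabs.
  - rewrite invf_ple ?posrE ?sqrtr_gt0//.
    have : Num.sqrt (lam0^-1 ^+ 2) <= Num.sqrt n%:R.
      by rewrite ler_sqrt//; near: n.
    by rewrite sqrtr_sqr gtr0_norm// invr_gt0.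
  - have := near tight n; apply => //.
    by move=> j; exact: measurable_partial_sum.
  - rewrite -mulrA mulrC -ler_pdivlMr//; apply: ltW.
    by near: n.
  - apply: (@le_trans _ _ (M' * Num.sqrt n%:R)).
      rewrite ler_wpM2r ?sqrtr_ge0// /M' lerD2r lerD2r ler_norm//.
    rewrite -(@ler_pXn2r _ 2%N) ?nnegrE//; last 2 first.
    + by rewrite mulr_ge0// ?sqrtr_ge0// ltW.
    + by rewrite mulr_ge0// ?divr_ge0// ltW.
    rewrite [leLHS]exprMn sqr_sqrtr ?ler0n// [leRHS]exprMn.
    have : n%:R / v n ^+ 2 <= (c / (2 * M')) ^+ 2 by apply: ltW; near: n.
    rewrite ler_pdivrMr ?exprn_gt0// => h1.
    have -> : (c / 2) ^+ 2 * v n ^+ 2 = M' ^+ 2 * ((c / (2 * M')) ^+ 2 * v n ^+ 2).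
      by field; rewrite gt_eqF.
    by rewrite ler_wpM2l// sqr_ge0.
have mS m : measurable [set w | c * v n <= maxabs m (S w)].
  rewrite -[X in measurable X]setTI; apply: measurable_fun_le => //.
  have [_ _ mm] := @lip_measurable_maxabs R m; apply: mm => j.
  exact: measurable_partial_sum.
have [mN N0] := same_law_null mu pstar dpstar _ (dp _ Aths) ths_law.
set N : set (Borel Z) := [set x | _] in mN N0.
(* The null event that some observation falls where [p ths] and [pstar] differ. *)
pose NX := \bigcup_i (X i @^-1` N).
have mXN i : measurable (X i @^-1` N).
  by rewrite -[X in measurable X]setTI; exact: (mX i).
have mNX : measurable NX by exact: bigcupT_measurable.
have PNX : P NX = 0%E.
  apply/negligibleP => //; apply: negligible_bigcup => i.
  by apply/negligibleP => //; exact: etrans (lawX i N mN) N0.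
(* These events increase with [m] and [bound] is uniform in [m], so the bound survives in the
   limit. *)
pose U := \bigcup_m [set w | c * v n <= maxabs m (S w)].
have mU : measurable U by exact: bigcupT_measurable.
have PU : (P U <= (expR (- (eta * c / 4) * (v n ^+ 2 / n%:R)))%:E)%E.
  have cvU : (P \o (fun m => [set w | c * v n <= maxabs m (S w)])) @ \oo --> P U.
    apply: nondecreasing_cvg_mu => // i j ij; apply/subsetPset => w /= /le_trans; apply.
    exact: maxabs_nondecreasing.
  rewrite -(cvg_lim _ cvU)//; apply: lime_le; first by apply/cvg_ex; exists (P U).
  by apply: nearW => m; exact: bound.
apply: le_trans PU.
rewrite -[leRHS]add0e -PNX.
apply: le_trans (measureU2 _ mNX mU).
apply: le_measure; rewrite ?inE//; first exact: measurableU.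
move=> w /Edev [th Ath ltth].
have [wN|wN] := pselect (NX w); [by left|right].
have pX i : p ths (X i w) = pstar (X i w).
  by apply/eqP; apply: contrapT => /negP neq; apply: wN; exists i.
have cl : {within A, continuous (fun th => loglik X p n th w)}.
  by apply: within_continuous_sum => i; exact: cp.
(* The log-likelihood is continuous in the parameter, so [th] can be replaced by a member of the
   dense sequence. *)
have [j ltj] := within_continuous_gt_dense _ _ s _ _ cl As (fun e => sd th e Ath) Ath ltth.
exists j.+1 => //=.
apply: le_trans (ler_maxabs j.+1 (S w) j (ltnSn j)).
apply: le_trans (ler_norm _).
have -> : S w j = loglik X p n (s j) w - loglik X p n ths w - n%:R * fine (dexp mu pstar (f j)).
  rewrite /S /partial_sum /h /centered sumrB sumr_const card_ord mulr_natl.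
  congr (_ - _); rewrite /loglik -sumrB; apply: eq_bigr => i _.
  by rewrite /f pX.
(* By Gibbs' inequality centering can only increase the log-likelihood ratio sum. *)
have : n%:R * fine (dexp mu pstar (f j)) <= 0.
  apply: mulr_ge0_le0 => //.
  exact: dexp_log_ratio_le0 dpstar pstar_lu mul iul _ (dp _ (As j)) (p_lu _ (As j)).
lra.
Unshelve. all: by end_near.
Qed.

End deviation.

(** * Order estimators as comparisons of criteria, and their measurability *)

Section selection.
Context {R : realType} {Z : completePseudoMetricType R} {d0 : measure_display}
  {Omega : measurableType d0} (X : nat -> Omega -> Borel Z) {Theta : Type}
  (ThetaK : nat -> set Theta) (p : Theta -> Z -> R) (pen : nat -> nat -> R).
Local Notation crit := (crit X ThetaK p pen).

(** A value strictly below a supremum is beaten by an actual parameter, and the criterion at [K] is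
    at least the penalized likelihood of [th]. *)
Lemma crit_lt_loglik n K K' th w : ThetaK K th ->
  (crit n K w < crit n K' w)%E ->
  exists2 th', ThetaK K' th' &
    loglik X p n th w + (pen n K' - pen n K) < loglik X p n th' w.
Proof.
move=> Kth ltc.
have : ((loglik X p n th w - pen n K)%:E < crit n K' w)%E.
  apply: le_lt_trans ltc; rewrite /Defs.crit EFinB leeB//.
  by apply: ereal_sup_ubound; exists th.
rewrite /Defs.crit lteBrDr// -EFinD => /ereal_sup_gt[_ [th' Kth' <-]].
by rewrite lte_fin => lt; exists th' => //; rewrite -subr_gt0 in lt *; lra.
Qed.

Lemma gt_opt_KhatL n w K0 : gt_opt (KhatL X ThetaK p pen n w) K0 <->
  forall K, (0 < K <= K0)%N -> (crit n K w < crit n K.+1 w)%E.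
Proof.
rewrite /KhatL; case: pselect => [ex|nex] /=; last first.
  split=> // _ K /andP[K_gt0 _]; rewrite ltNge; apply/negP => le.
  by apply: nex; exists K; exact/asboolP.
case: ex_minnP => m /asboolP[m0 lem] minm; split => [lt K /andP[K_gt0 leK]|H].
  rewrite ltNge; apply/negP => le.
  have := minm K (asboolT (conj K_gt0 le)).
  by rewrite leqNgt (leq_ltn_trans leK lt).
rewrite ltnNge; apply/negP => lemK.
by have := H m; rewrite m0 lemK ltNge lem => /(_ isT).
Qed.

Definition maximizes (Kmax n K : nat) (w : Omega) : Prop :=
  (0 < K <= Kmax)%N /\
  forall j, (0 < j <= Kmax)%N -> (crit n j w <= crit n K w)%E.

(** The existence clause excludes the default value 0 that [KhatG] takes when there is no
    maximizer. *)
Lemma lt_KhatG Kmax n w K0 : (K0 < KhatG X ThetaK p pen Kmax n w)%N <->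
  (exists K, maximizes Kmax n K w) /\
  forall K, (K <= K0)%N -> ~ maximizes Kmax n K w.
Proof.
rewrite /KhatG; case: pselect => [ex|nex] /=; last first.
  split=> // -[[K mK] _]; exfalso; apply: nex; exists K; exact/asboolP.
case: ex_minnP => m /asboolP mm minm; split => [lt|[_ H]].
  split; first by exists m.
  move=> K leK mK; have := minm K (asboolT mK).
  by rewrite leqNgt (leq_ltn_trans leK lt).
by rewrite ltnNge; apply/negP => lem; exact: H lem mm.
Qed.

Hypothesis msup : forall n K, measurable_fun [set: Omega]
  (suplik X ThetaK p n K : Omega -> \bar R).

Lemma measurable_crit n K : measurable_fun [set: Omega] (crit n K).
Proof. exact: emeasurable_funB. Qed.

Lemma measurable_KhatL n K0 :
  measurable [set w | gt_opt (KhatL X ThetaK p pen n w) K0].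
Proof.
rewrite (_ : [set w | _] = \bigcap_(K in [set K | (0 < K <= K0)%N])
    [set w | (crit n K w < crit n K.+1 w)%E]).
  apply: bigcap_measurableType => K _; rewrite -[X in measurable X]setTI.
  by apply: measurable_lte => //; exact: measurable_crit.
by apply/seteqP; split => w /= /gt_opt_KhatL.
Qed.

Lemma measurable_maximizes Kmax n K : measurable [set w | maximizes Kmax n K w].
Proof.
case: (boolP (0 < K <= Kmax)%N) => Kb; last first.
  rewrite (_ : [set w | _] = set0)//; apply/seteqP; split => // w [Kb' _].
  by rewrite Kb' in Kb.
rewrite (_ : [set w | _] = \bigcap_(j in [set j | (0 < j <= Kmax)%N])
    [set w | (crit n j w <= crit n K w)%E]).
  apply: bigcap_measurableType => j _; rewrite -[X in measurable X]setTI.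
  by apply: measurable_lee => //; exact: measurable_crit.
by apply/seteqP; split => w /=; [case|split].
Qed.

Lemma measurable_KhatG Kmax n K0 :
  measurable [set w | (K0 < KhatG X ThetaK p pen Kmax n w)%N].
Proof.
rewrite (_ : [set w | _] = (\bigcup_K [set w | maximizes Kmax n K w]) `&`
    \bigcap_(K in [set K | (K <= K0)%N]) ~` [set w | maximizes Kmax n K w]).
  apply: measurableI.
    by apply: bigcupT_measurable => K; exact: measurable_maximizes.
  apply: bigcap_measurableType => K _; apply: measurableC.
  exact: measurable_maximizes.
apply/seteqP; split => w /=.
  by move=> /lt_KhatG[[K mK] H]; split; [exists K|].
by move=> [[K _ mK] H]; apply/lt_KhatG; split; [exists K|].
Qed.

End selection.

(** * Logarithmic rates and the two overestimation bounds *)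

Lemma log_rate_le {R : realType} (v : nat -> R) (q : nat -> \bar R) (k : R) n :
  (0 < n)%N -> 0 < v n -> (0 <= q n)%E ->
  (q n <= (expR (- k * (v n ^+ 2 / n%:R)))%:E)%E ->
  (log_rate v q n <= (- k)%:E)%E.
Proof.
move=> n0 vn q0 qle; rewrite /log_rate; case: eqP => [_|/eqP qn0].
  exact: leNye.
have nR : 0 < n%:R :> R by rewrite ltr0n.
have qf : q n \is a fin_num by rewrite ge0_fin_numE// (le_lt_trans qle)// ltry.
have qp : 0 < fine (q n) by rewrite lt_def qn0 fine_ge0.
rewrite lee_fin -ler_pdivlMl ?divr_gt0 ?exprn_gt0//.
have -> : (n%:R / v n ^+ 2)^-1 * - k = - k * (v n ^+ 2 / n%:R).
  by rewrite invf_div mulrC.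
by rewrite -ler_expR lnK// -lee_fin fineK.
Qed.

Theorem theorem10
  (R : realType)
  (* the Polish sample space with its Borel sigma-field and a sigma-finite measure *)
  (Z : completePseudoMetricType R) (HZ : polish Z)
  (mu : {measure set (Borel Z) -> \bar R}) (Hmu : sigma_finite [set: Borel Z] mu)
  (* the true density p^star *)
  (pstar : Z -> R) (Hpstar : is_density mu pstar)
  (* nested parameter spaces Theta_K (K >= 1) inside a metric space, and densities p_theta *)
  (Theta : pseudoMetricType R) (HTheta : hausdorff_space Theta)
  (ThetaK : nat -> set Theta)
  (Hnest : forall K, (0 < K)%N -> ThetaK K `<=` ThetaK K.+1)
  (p : Theta -> Z -> R)
  (Hp : forall th, (\bigcup_(K in [set K | (0 < K)%N]) ThetaK K) th -> is_density mu (p th))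
  (* (A1) *)
  (HA1 : forall K, (0 < K)%N ->
     compact (ThetaK K) /\ weakly_compact_model mu ThetaK p K)
  (* (A2) *)
  (HA2 : forall (z : Z) K, (0 < K)%N ->
     {within ThetaK K, continuous (fun th => ln (p th z))})
  (* (A3) *)
  (l u : Z -> R)
  (HA3int : measurable_fun [set: Borel Z] ((u \- l) : Borel Z -> R) /\
            (dexp mu pstar (fun x => `|u x - l x|%R) < +oo)%E)
  (HA3star : forall x, 0 < pstar x /\ l x <= ln (pstar x) <= u x)
  (HA3 : forall th, (\bigcup_(K in [set K | (0 < K)%N]) ThetaK K) th ->
     forall x, 0 < p th x /\ l x <= ln (p th x) <= u x)
  (* penalty pen(n,K) = v_n D(K) and (A4) *)
  (v : nat -> R) (D : nat -> R)
  (Hvpos : forall n, (0 < n)%N -> 0 < v n)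
  (Hvincr : forall n, (0 < n)%N -> v n <= v n.+1)
  (Hvo : (fun n => v n / n%:R) @ \oo --> 0)
  (A delta : R) (HA : 1 <= A) (Hdelta : 0 < delta < 1)
  (Hvreg : forall k n, (0 < k)%N -> (0 < n)%N ->
     v (n * k)%N <= A * (k%:R `^ (1 - delta)) * v n)
  (HA4pos : forall n K, (0 < n)%N -> (0 < K)%N -> 0 < v n * D K)
  (HA4incr : forall n K, (0 < n)%N -> (0 < K)%N -> v n * D K < v n * D K.+1)
  (HA4inf : forall K, (0 < K)%N -> (fun n => v n * D K) @ \oo --> +oo)
  (HA4o : forall K, (0 < K)%N -> (fun n => (v n * D K) / n%:R) @ \oo --> 0)
  (* (i) and (ii) *)
  (Hi : in_Ltau mu pstar (u \- l))
  (Hii : (fun n => n%:R / (v n ^+ 2)) @ \oo --> 0)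
  (* the true order K^star *)
  (Kstar : nat) (HKstar1 : (0 < Kstar)%N)
  (HKstar : in_model mu ThetaK p pstar Kstar)
  (HKstar' : ~ in_model mu ThetaK p pstar Kstar.-1)
  (* the i.i.d. sample Z_1, Z_2, ... with law P^star *)
  (d0 : measure_display) (Omega : measurableType d0) (P : probability Omega R)
  (X : nat -> Omega -> Borel Z) (HX : iid P X (dmeas mu pstar))
  (* suprema are measurable *)
  (Hmeas : forall n K, measurable_fun [set: Omega]
     (suplik X ThetaK p n K : Omega -> \bar R)) :
  let pen := fun n K => v n * D K in
  let ga := fun K => [set f : Z -> R | exists2 th, ThetaK K th &
                        f = (fun z => ln (p th z) - ln (pstar z))] in
  (* (a) *)
  (donsker P X mu pstar (ga Kstar.+1) ->
     (limn_esup (log_rate v (fun n =>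
        P [set w | gt_opt (KhatL X ThetaK p pen n w) Kstar])) < 0)%E) /\
  (* (b) *)
  (forall Kmax : nat, (Kstar <= Kmax)%N ->
     donsker P X mu pstar (ga Kmax) ->
     (limn_esup (log_rate v (fun n =>
        P [set w | (Kstar < KhatG X ThetaK p pen Kmax n w)%N])) < 0)%E).
Proof.
move=> pen ga.
have [_ [ths Kths lths]] := HKstar.
have Hsub j k : (0 < j)%N -> (j <= k)%N -> ThetaK j `<=` ThetaK k.
  move=> j0 /subnK <-; elim: (k - j)%N => [//|i IH] th /IH.
  by apply: Hnest; rewrite addn_gt0 j0 orbT.
have v1 : 0 < v 1%N by exact: Hvpos.
(* Monotonicity of the penalty at sample size 1, divided by [v 1 > 0]. *)
have Dlt K : (0 < K)%N -> D K < D K.+1.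
  by move=> K0; have := HA4incr 1%N K isT K0; rewrite ltr_pM2l.
have Dle j k : (0 < j)%N -> (j <= k)%N -> D j <= D k.
  move=> j0 /subnK <-; elim: (k - j)%N => [//|i IH].
  by apply: le_trans IH _; apply/ltW/Dlt; rewrite addn_gt0 j0 orbT.
have c0 : 0 < D Kstar.+1 - D Kstar by rewrite subr_gt0; exact: Dlt.
(* Common to both estimators: if [E n] forces some order [j] in [Kstar < j <= K] to beat [Kstar],
   the likelihood gain exceeds the penalty gap, at least [(D Kstar.+1 - D Kstar) * v n], so [E n]
   lies in the overfitting event of [ThetaK K]. *)
have key K (E : nat -> set Omega) : (Kstar < K)%N -> donsker P X mu pstar (ga K) ->
    (forall n, measurable (E n)) ->
    (forall n w, (0 < n)%N -> E n w -> exists2 j, (Kstar < j <= K)%N &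
       (crit X ThetaK p pen n Kstar w < crit X ThetaK p pen n j w)%E) ->
    (limn_esup (log_rate v (fun n => P (E n))) < 0)%E.
  move=> KK don mE HE.
  have K0 : (0 < K)%N by exact: leq_ltn_trans KK.
  have inU th : ThetaK K th -> (\bigcup_(K in [set K | (0 < K)%N]) ThetaK K) th.
    by exists K.
  have [k k0 dev] := @overfit_deviation R Z mu pstar l u Hmu Hpstar HA3star
    HA3int.1 HA3int.2 Hi Theta (ThetaK K) p ths (HA1 K K0).1
    (fun th Kth => Hp th (inU th Kth)) (fun th Kth => HA3 th (inU th Kth))
    (fun z => HA2 z K K0) (Hsub _ _ HKstar1 (ltnW KK) _ Kths) lths
    d0 Omega P X HX don v (D Kstar.+1 - D Kstar) Hvpos Hvo Hii c0.
  apply: (limn_esup_lt0 _ k) => //.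
  have n_gt0 : \forall n \near \oo, (0 < n)%N by exists 1%N.
  apply: filterS2 n_gt0 dev => n n0 dev.
  apply: log_rate_le => //; first exact: Hvpos.
  apply: dev => // w /(HE n w n0)[j /andP[Kj jK] ltc].
  have [th jth ltth] := crit_lt_loglik _ _ _ _ _ _ _ _ _ Kths ltc.
  exists th; first by apply: Hsub jth => //; exact: leq_ltn_trans Kj.
  apply: le_lt_trans ltth; rewrite lerD2l /pen -mulrBr mulrC.
  by rewrite ler_pM2l ?Hvpos// lerB// Dle.
split.
(* Passing beyond [Kstar] requires the criterion to increase strictly from [Kstar] to [Kstar.+1], so
   this single comparison suffices. *)
- move=> don; apply: (key Kstar.+1) => //.
    by move=> n; exact: measurable_KhatL.
  move=> n w n0 /gt_opt_KhatL H; exists Kstar.+1; first by rewrite ltnSn.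
  by apply: H; rewrite HKstar1 leqnn.
- move=> Kmax; rewrite leq_eqVlt => /predU1P[<- _|KK don].
    (* When [Kmax = Kstar] the event is empty and the rate is constantly [-oo]. *)
    rewrite (_ : log_rate _ _ = cst -oo%E).
      by apply: (limn_esup_lt0 _ 1) => //; apply: nearW => n; exact: leNye.
    apply/funext => n; rewrite /log_rate (_ : [set w | _] = set0).
      by rewrite measure0 eqxx.
    apply/seteqP; split => // w /= /lt_KhatG[[K mK] H].
    by have [/andP[_ leK] _] := mK; exact: H leK mK.
  apply: (key Kmax) => //.
    by move=> n; exact: measurable_KhatG.
  move=> n w n0 /lt_KhatG[[K mK] H].
  have KsK : (Kstar < K)%N.
    by rewrite ltnNge; apply/negP => leK; exact: H leK mK.
  case: mK => /andP[K0 KKmax] maxK.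
  exists K; first by rewrite KsK.
  (* Otherwise [Kstar] would also be a maximizer, contradicting that the smallest one is larger. *)
  rewrite ltNge; apply/negP => le.
  apply: (H Kstar (leqnn _)); split; first by rewrite HKstar1 ltnW.
  by move=> j jb; apply: le_trans (maxK j jb) le.
Qed.
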